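(* For a given realization of $\theta$, let $\tilde{\boldsymbol F}=\mathbb E_{\boldsymbol Y}\left[\frac{\partial\ln f(\boldsymbol Y|\boldsymbol\zeta)}{\partial\boldsymbol\zeta}\left(\frac{\partial\ln f(\boldsymbol Y|\boldsymbol\zeta)}{\partial\boldsymbol\zeta}\right)^H\right]$ be the Fisher information matrix (FIM) for estimating $\boldsymbol\zeta=[\theta,\alpha_R,\alpha_I]^T$ without prior information. The Cramér-Rao bound (CRB) corresponding to the given realization of $\theta$ is $$\mathrm{CRB}_\theta(\theta)=[\tilde{\boldsymbol F}^{-1}]_{1,1}=\frac{\frac{\sigma_s^2}{2|\alpha|^2L}}{\|\dot{\boldsymbol b}(\theta)\|^2\,\mathrm{tr}(\boldsymbol a(\theta)\boldsymbol a^H(\theta)\boldsymbol W)} ,$$ and the average (expected) CRB is $\mathrm{CRB}_\theta=\mathbb E_\theta[\mathrm{CRB}_\theta(\theta)]=\int\mathrm{CRB}_\theta(\theta)p_\Theta(\theta)\,d\theta$. Then $$\mathrm{CRB}_\theta\;\ge\;\frac{\frac{\sigma_s^2}{2|\alpha|^2L}}{\mathrm{tr}(\boldsymbol A_1\boldsymbol W)}\;\ge\;\mathrm{PCRB}_\theta^U\;\ge\;\mathrm{PCRB}_\theta ,$$ where $\mathrm{PCRB}_\theta=[\boldsymbol F^{-1}]_{1,1}$ is the posterior Cramér-Rao bound (PCRB), given by $$\mathrm{PCRB}_\theta=\frac{1}{\sum_{k=1}^{K}\frac{p_k}{\sigma_k^2}-\rho+\frac{2|\alpha|^2L}{\sigma_s^2}\left(\mathrm{tr}((\boldsymbol{A}_1+\boldsymbol{A}_2)\boldsymbol{W})-\frac{|\mathrm{tr}(\boldsymbol{A}_3\boldsymbol{W})|^2}{\mathrm{tr}(\boldsymbol{A}_4\boldsymbol{W})}\right)},$$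 and $$\mathrm{PCRB}_\theta^U=\frac{1}{\sum_{k=1}^{K}\frac{p_k}{\sigma_k^2}-\rho+\frac{2|\alpha|^2L}{\sigma_s^2}\mathrm{tr}(\boldsymbol{A}_1\boldsymbol{W})} .$$ That is, the PCRB with exploitation of the prior distribution of $\theta$ is always no larger than the CRB averaged over the random realizations of $\theta$ without exploitation of the prior.
   Context: A base station with $N_t\ge1$ transmit and $N_r\ge1$ receive antennas sends $\boldsymbol x_1,\dots,\boldsymbol x_L\in\mathbb C^{N_t\times1}$ over $L$ symbol intervals, with transmit covariance matrix $\boldsymbol W=\mathbb E[\boldsymbol x_l\boldsymbol x_l^H]\succeq\boldsymbol 0$ for all $l$, and $\boldsymbol X=[\boldsymbol x_1,\dots,\boldsymbol x_L]$. It receives the echo $\boldsymbol Y=\boldsymbol G(\theta)\boldsymbol X+[\boldsymbol n_1,\dots,\boldsymbol n_L]$ with $\boldsymbol G(\theta)=\alpha\boldsymbol b(\theta)\boldsymbol a^H(\theta)$ and noise $\boldsymbol n_l\sim\mathcal{CN}(\boldsymbol 0,\sigma_s^2\boldsymbol I_{N_r})$. Here $\alpha=\alpha_R+j\alpha_I\in\mathbb C$ is an unknown deterministic reflection coefficient, and $\theta\in[-\frac\pi2,\frac\pi2)$ is the unknown random azimuth angle of the target, with known density $p_\Theta$. The steering vectors are $a_n(\theta)=e^{-j\pi d(N_t-2n+1)\cos\phi\sin\theta/\lambda}$ ($n=1,\dots,N_t$) and $b_m(\theta)=e^{-j\pi d(N_r-2m+1)\cos\phi\sin\theta/\lambda}$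 ($m=1,\dots,N_r$), where $j$ is the imaginary unit, $d$ is the antenna spacing, $\lambda$ the wavelength, and $\cos\phi=\sqrt{r^2-h_B^2}/r$ with $r$ the target distance and $h_B\ge0$ the antenna height. $\dot{\boldsymbol a}(\theta),\dot{\boldsymbol b}(\theta)$ are the derivatives of $\boldsymbol a(\theta),\boldsymbol b(\theta)$ with respect to $\theta$. The superscript $H$ is conjugate transpose. The conditional density $f(\boldsymbol Y|\boldsymbol\zeta)$ of $\boldsymbol Y$ given $\boldsymbol\zeta$ satisfies $\ln f(\boldsymbol Y|\boldsymbol\zeta)=\frac{2}{\sigma_s^2}\mathrm{Re}\{\mathrm{tr}(\boldsymbol X^H\boldsymbol G^H(\theta)\boldsymbol Y)\}-\frac{\|\boldsymbol Y\|_F^2+\|\boldsymbol G(\theta)\boldsymbol X\|_F^2}{\sigma_s^2}-N_rL\ln(\pi\sigma_s^2)$. The prior density is the Gaussian mixture $p_\Theta(\theta)=\sum_{k=1}^K p_kf_k(\theta)$, $f_k(\theta)=\frac{1}{\sqrt{2\pi}\sigma_k}e^{-(\theta-\theta_k)^2/(2\sigma_k^2)}$, with $K\ge1$, $p_k\in[0,1]$, $\sum_kp_k=1$, $\theta_k\in[-\frac\pi2,\frac\pi2)$, and variances $\sigma_k^2$ sufficiently small that the probability for $\theta$ to exceed $[-\frac\pi2,\frac\pi2)$ is negligible. Integrals are over $\theta$. Define $$\rho=\int\frac{\sum_{k_1=1}^K\sum_{k_2=1}^K p_{k_1}p_{k_2}f_{k_1}(\theta)f_{k_2}(\theta)\left(\frac{\theta-\theta_{k_1}}{\sigma_{k_1}^2}-\frac{\theta-\theta_{k_2}}{\sigma_{k_2}^2}\right)^2}{2\sum_{k=1}^K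 p_kf_k(\theta)}\,d\theta ,$$ so that $\sum_k\frac{p_k}{\sigma_k^2}-\rho=\int\left(\frac{\partial\ln p_\Theta(\theta)}{\partial\theta}\right)^2p_\Theta(\theta)\,d\theta\ge0$. Define $\boldsymbol A_1=\int\|\dot{\boldsymbol b}(\theta)\|^2\boldsymbol a(\theta)\boldsymbol a^H(\theta)p_\Theta(\theta)d\theta$, $\boldsymbol A_2=N_r\int\dot{\boldsymbol a}(\theta)\dot{\boldsymbol a}^H(\theta)p_\Theta(\theta)d\theta$, $\boldsymbol A_3=N_r\int\dot{\boldsymbol a}(\theta)\boldsymbol a^H(\theta)p_\Theta(\theta)d\theta$, $\boldsymbol A_4=N_r\int\boldsymbol a(\theta)\boldsymbol a^H(\theta)p_\Theta(\theta)d\theta$. The FIM exploiting the prior is $\boldsymbol F=\boldsymbol F_o+\boldsymbol F_p$. Here $\boldsymbol F_o=\mathbb E_{\boldsymbol Y,\boldsymbol\zeta}\left[\frac{\partial\ln f(\boldsymbol Y|\boldsymbol\zeta)}{\partial\boldsymbol\zeta}\left(\frac{\partial\ln f(\boldsymbol Y|\boldsymbol\zeta)}{\partial\boldsymbol\zeta}\right)^H\right]=\begin{bmatrix}J_{\theta\theta}&\boldsymbol J_{\theta\alpha}\\ \boldsymbol J_{\theta\alpha}^H&\boldsymbol J_{\alpha\alpha}\end{bmatrix}$ with $J_{\theta\theta}=\frac{2|\alpha|^2L}{\sigma_s^2}\mathrm{tr}((\boldsymbol A_1+\boldsymbol A_2)\boldsymbol W)$, $\boldsymbol J_{\theta\alpha}=\frac{2L}{\sigma_s^2}\mathrm{tr}(\boldsymbol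 A_3\boldsymbol W)[\alpha_R,\alpha_I]$, $\boldsymbol J_{\alpha\alpha}=\frac{2L}{\sigma_s^2}\mathrm{tr}(\boldsymbol A_4\boldsymbol W)\boldsymbol I_2$. The matrix $\boldsymbol F_p$ has $[\boldsymbol F_p]_{1,1}=\sum_k\frac{p_k}{\sigma_k^2}-\rho$ and all other entries $0$.
   Formalization: The closed form of CRB_θ(θ) fails for general W (e.g. N_t=N_r=2, W=I), so it is stated only at θ where |tr(ȧaᴴW)|² = tr(ȧȧᴴW)·tr(aaᴴW); the inequality chain is for all W, with both [F̃⁻¹]₁₁ and the closed form as CRB. *)

(* Defs.v *)
From HB Require Import structures.
From mathcomp Require Import all_boot all_order all_algebra.
From mathcomp Require Import all_classical all_reals all_analysis.
From mathcomp Require Import complex.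

Set Implicit Arguments.
Unset Strict Implicit.
Unset Printing Implicit Defensive.

Import Order.TTheory GRing.Theory Num.Theory.
Import numFieldNormedType.Exports.

Local Open Scope classical_set_scope.
Local Open Scope ring_scope.
Local Open Scope complex_scope.

Local Notation Re := complex.Re.
Local Notation Im := complex.Im.

Notation "M ^H" := (map_mx (@conjc _) (trmx M))
  (at level 8, format "M ^H") : ring_scope.

Section Complex.
Context {R : realType}.
Local Notation C := R[i].

Definition expi (x : R) : C := cos x +i* sin x.

Definition sqmod (z : C) : R := Re z ^+ 2 + Im z ^+ 2.

(* Squared Frobenius norm; on a column it is the squared Euclidean norm. *)
Definition sqnorm m n (M : 'M[C]_(m, n)) : R := \sum_i \sum_j sqmod (M i j).

(* Derivative of a matrix-valued function of a real variable. *)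
Definition derivmx m n (f : R -> 'M[C]_(m, n)) (t : R) : 'M[C]_(m, n) :=
  \matrix_(i, j) (derive1 (fun s => Re (f s i j)) t +i* derive1 (fun s => Im (f s i j)) t).

(* Integral (expectation, when mu is a probability) of a complex matrix. *)
Definition integralmx d (T : measurableType d) (mu : {measure set T -> \bar R})
    m n (f : T -> 'M[C]_(m, n)) : 'M[C]_(m, n) :=
  \matrix_(i, j) ((\int[mu]_x Re (f x i j)) +i* (\int[mu]_x Im (f x i j))).

(* Real coordinates of a complex matrix: the flag selects the imaginary part. *)
Definition rcoord m n (M : 'M[C]_(m, n)) (k : 'I_m * 'I_n * bool) : R :=
  if k.2 then Im (M k.1.1 k.1.2) else Re (M k.1.1 k.1.2).

End Complex.

Section Steering.
Context {R : realType}.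
Local Notation C := R[i].

Record geometry := Geometry {
  spacing : R; wavelength : R; range_ : R; height : R }.

Definition cosphi (g : geometry) : R :=
  Num.sqrt (range_ g ^+ 2 - height g ^+ 2) / range_ g.

(* Row i : 'I_N carries the antenna with one-based index i.+1. *)
Definition steering (N : nat) (g : geometry) (t : R) : 'cV[C]_N :=
  \col_i expi (- (pi * spacing g * (N%:R - 2 * i.+1%:R + 1)
                  * cosphi g * sin t / wavelength g)).

(* G(theta) = alpha b(theta) a(theta)^H. *)
Definition channel Nt Nr (g : geometry) (alpha : C) (t : R) : 'M[C]_(Nr, Nt) :=
  alpha *: (steering Nr g t *m (steering Nt g t)^H).

End Steering.
Arguments geometry : clear implicits.

Section Model.
Context {R : realType} {d : measure_display} {Omega : measurableType d}.
Variable P : probability Omega R.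
Local Notation C := R[i].

(* The columns of X are square-integrable with E[x_l x_l^H] = W, which
   makes W Hermitian positive semidefinite; no law or independence across l is
   imposed. *)
Definition transmit_signal Nt L (W : 'M[C]_Nt) (X : Omega -> 'M[C]_(Nt, L)) :=
  [/\ forall k, measurable_fun [set: Omega] (fun w => rcoord (X w) k),
      forall k, P.-integrable [set: Omega] (fun w => (rcoord (X w) k ^+ 2)%:E) &
      forall l, integralmx P (fun w => col l (X w) *m (col l (X w))^H) = W].

(* The entries of N are i.i.d. CN(0, sigma^2), i.e., their real and imaginary
   parts are i.i.d. normal of variance sigma^2 / 2, and the whole noise is
   independent of X.  Taking A k = setT in the product rule gives the mutual
   independence of the noise coordinates. *)
Definition awgn Nt Nr L (sigma : R) (X : Omega -> 'M[C]_(Nt, L))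
    (N : Omega -> 'M[C]_(Nr, L)) :=
  [/\ forall k, measurable_fun [set: Omega] (fun w => rcoord (N w) k),
      forall k (B : set R), measurable B ->
        P [set w | B (rcoord (N w) k)] = normal_prob 0 (sigma / Num.sqrt 2) B &
      forall (A : 'I_Nt * 'I_L * bool -> set R)
             (B : 'I_Nr * 'I_L * bool -> set R),
        (forall k, measurable (A k)) -> (forall k, measurable (B k)) ->
        (P ([set w | forall k, A k (rcoord (X w) k)] `&`
            [set w | forall k, B k (rcoord (N w) k)]) =
         P [set w | forall k, A k (rcoord (X w) k)] *
           \prod_k P [set w | B k (rcoord (N w) k)])%E].

End Model.

Section FisherInformation.
Context {R : realType}.
Local Notation C := R[i].
Local Notation mu := (@lebesgue_measure R).

Definition zeta (t : R) (alpha : C) : 'cV[R]_3 :=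
  \col_(i < 3) [:: t; Re alpha; Im alpha]`_i.

(* ln f(Y | zeta); X is known at the receiver. *)
Definition loglik Nt Nr L (g : geometry R) (sigma : R) (X : 'M[C]_(Nt, L))
    (Y : 'M[C]_(Nr, L)) (z : 'cV[R]_3) : R :=
  let G : 'M[C]_(Nr, Nt) := channel Nt Nr g (z 1 0 +i* z ord_max 0) (z 0 0) in
  2 / sigma ^+ 2 * Re (\tr (X^H *m G^H *m Y))
  - (sqnorm Y + sqnorm (G *m X)) / sigma ^+ 2
  - (Nr * L)%:R * ln (pi * sigma ^+ 2).

Definition score Nt Nr L (g : geometry R) (sigma : R) (X : 'M[C]_(Nt, L))
    (Y : 'M[C]_(Nr, L)) (z : 'cV[R]_3) : 'cV[R]_3 :=
  \col_i 'D_(delta_mx i 0) (loglik g sigma X Y) z.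

(* Fisher information matrix at the realization t of the angle: the score is
   differentiated at fixed (X, Y), then averaged over Y = G(t) X + N. *)
Definition fim d (Omega : measurableType d) (P : probability Omega R)
    Nt Nr L (g : geometry R) (sigma : R) (X : Omega -> 'M[C]_(Nt, L))
    (N : Omega -> 'M[C]_(Nr, L)) (alpha : C) (t : R) : 'M[R]_3 :=
  let s w := score g sigma (X w) (channel Nt Nr g alpha t *m X w + N w)
               (zeta t alpha) in
  \matrix_(i, j) \int[P]_w ((s w *m (s w)^T) i j).

Record mixture K := Mixture {
  weight : 'I_K -> R; mean : 'I_K -> R; stddev : 'I_K -> R }.

Definition prior K (q : mixture K) (t : R) : R :=
  \sum_k weight q k * normal_pdf (mean q k) (stddev q k) t.

Definition rho K (q : mixture K) : R :=
  let f k t := normal_pdf (mean q k) (stddev q k) t in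
  let u k t := (t - mean q k) / stddev q k ^+ 2 in
  \int[mu]_t
    ((\sum_k1 \sum_k2
        weight q k1 * weight q k2 * f k1 t * f k2 t * (u k1 t - u k2 t) ^+ 2)
     / (2 * \sum_k weight q k * f k t)).

Definition prior_info K (q : mixture K) : R :=
  \sum_k weight q k / stddev q k ^+ 2 - rho q.

(* F = F_o + F_p; F_o averages over (Y, theta), alpha being deterministic. *)
Definition bayesian_fim d (Omega : measurableType d) (P : probability Omega R)
    Nt Nr L K (g : geometry R) (sigma : R) (X : Omega -> 'M[C]_(Nt, L))
    (N : Omega -> 'M[C]_(Nr, L)) (alpha : C) (q : mixture K) : 'M[R]_3 :=
  \matrix_(i, j) \int[mu]_t (fim P g sigma X N alpha t i j * prior q t)
  + prior_info q *: delta_mx 0 0.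

Section PriorMatrices.
Variables (Nt Nr K : nat) (g : geometry R) (q : mixture K).
Local Notation a := (steering Nt g).
Local Notation b := (steering Nr g).

Definition A1 : 'M[C]_Nt :=
  integralmx mu (fun t =>
    (sqnorm (derivmx b t) * prior q t)%:C *: (a t *m (a t)^H)).
Definition A2 : 'M[C]_Nt :=
  Nr%:R *: integralmx mu (fun t =>
    (prior q t)%:C *: (derivmx a t *m (derivmx a t)^H)).
Definition A3 : 'M[C]_Nt :=
  Nr%:R *: integralmx mu (fun t =>
    (prior q t)%:C *: (derivmx a t *m (a t)^H)).
Definition A4 : 'M[C]_Nt :=
  Nr%:R *: integralmx mu (fun t =>
    (prior q t)%:C *: (a t *m (a t)^H)).

End PriorMatrices.

(* [M^-1]_{1,1} as a bound on a variance: infinite when M is singular. *)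
Definition inv11 (M : 'M[R]_3) : \bar R :=
  if M \in unitmx then (invmx M 0 0)%:E else +oo%E.

(* E_theta[h(theta)], possibly infinite. *)
Definition prior_mean K (q : mixture K) (h : R -> \bar R) : \bar R :=
  (\int[mu]_t (h t * (prior q t)%:E))%E.

End FisherInformation.
Arguments mixture : clear implicits.
Arguments A1 {R Nt} Nr {K} g q.
Arguments A2 {R Nt} Nr {K} g q.
Arguments A3 {R Nt} Nr {K} g q.
Arguments A4 {R Nt} Nr {K} g q.

(* Main.v *)
(* The score is linear in the noise: its coordinate along zeta_i is
   (2 / sigma^2) Re tr((M_i X)^H N), with M_i the derivative of the channel
   along zeta_i.  Hence the Fisher matrix at theta is
   (2 L / sigma^2) Re tr(M_i^H M_j W).  The array being centred, b^H b' = 0, and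
   this matrix is an arrow [[J, u, v], [u, s, 0], [v, 0, s]], whose inverse has
   corner entry (J - (u^2 + v^2) / s)^-1.  Averaging over the prior keeps the
   arrow shape, which gives the closed form of the PCRB; the Cauchy-Schwarz
   inequality for the averaged form W bounds it by PCRBU, and PCRBU <= mid because
   the prior information, the integral of (p'/p)^2 p, is nonnegative.
   Both averaged bounds are infinite: a and b have derivatives proportional to
   cos theta, so the Schur complement is O(cos^2 theta), its inverse has a
   double pole at pi/2, and the Gaussian mixture is positive there. *)
Require Import Defs.
From HB Require Import structures.
From mathcomp Require Import all_boot all_order all_algebra.
From mathcomp Require Import all_classical all_reals all_analysis.
From mathcomp Require Import measurable_realfun complex ring lra.
Set Implicit Arguments.
Unset Strict Implicit.
Unset Printing Implicit Defensive.
Import Order.TTheory GRing.Theory Num.Theory.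
Import numFieldNormedType.Exports.
Local Open Scope classical_set_scope.
Local Open Scope ring_scope.
Local Open Scope complex_scope.


(** * Second moments of the normal law *)

(** The signal is known only through square integrability and its covariance, and the noise only
    through a product rule on boxes of real coordinates. All probability is therefore reduced to
    fourth-order moments, two signal and two noise coordinates each, and independence has to be
    carried from boxes to products of coordinates. The prior is integrated over the whole line, so
    [pi / 2] is an interior point where it has positive mass on both sides. The inequalities
    [mid <= prior_mean] are thus comparisons with [+oo], and divergence is shown from below by an
    indicator function, which applies to the possibly singular [inv11] directly. Cauchy-Schwarz is
    kept as a family of inequalities indexed by a complex [z]. For fixed [z] each is linear in the
    three traces and survives averaging over the prior; the optimal [z] is inserted only afterwards,
    pointwise or for the averages. Vanishing denominators are given the value [+oo], so each
    comparison of inverses has a degenerate case. *)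

Section GaussMoment.
Context {R : realType}.
Local Notation mu := (@lebesgue_measure R).
Import gauss_integral_proof.

Lemma cvg_integral0_gauss :
  @integral0_gauss R x @[x --> +oo] --> Num.sqrt pi / 2.
Proof.
rewrite (_ : integral0_gauss = fun x : R => Num.sqrt (integral0_gauss x ^+ 2)).
  rewrite (_ : Num.sqrt pi / 2 = Num.sqrt (pi / 4)).
    apply: continuous_cvg; first exact: sqrt_continuous.
    exact: cvg_integral0_gauss_sqr.
  rewrite sqrtrM ?pi_ge0// sqrtrV// (_ : 4 = 2 ^+ 2 :> R); last by ring.
  by rewrite sqrtr_sqr ger0_norm.
by apply/funext => x; rewrite sqrtr_sqr ger0_norm// integral0_gauss_ge0.
Qed.

(** The boundary term of the integration by parts for the second moment. The bound [x^-1] comes from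
    exp(x^2) >= 1 + x^2. *)
Lemma cvg_id_mul_gauss_fun : x * @gauss_fun R x @[x --> +oo] --> (0 : R).
Proof.
apply: (@squeeze_cvgr _ _ _ _ (cst 0) (fun x : R => x^-1)).
- near=> x => /=.
  have x0 : 0 < x by [].
  apply/andP; split; first by rewrite mulr_ge0 ?gauss_fun_ge0 ?ltW.
  rewrite /gauss_fun expRN ler_pdivrMr ?expR_gt0//.
  rewrite ler_pdivlMl//.
  apply: le_trans (expR_ge1Dx _).
  by rewrite expr2 lerDr.
- exact: cvg_cst.
- by apply/gtr0_cvgV0; [near=> x|exact: cvg_id].
Unshelve. all: by end_near. Qed.

Lemma integrable_gauss_segment (a b : R) :
  mu.-integrable `[a, b] (EFin \o gauss_fun).
Proof. exact: (integrableS _ _ _ integrableT_gauss). Qed.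

Lemma integral_gauss_fun_moment2 :
  (\int[mu]_x (x ^+ 2 * gauss_fun x)%:E)%E = (Num.sqrt pi / 2)%:E.
Proof.
have cg : continuous (fun x : R => x ^+ 2 * gauss_fun x).
  by move=> x; apply: cvgM; [exact: exprn_continuous|exact: continuous_gauss_fun].
rewrite ge0_symfun_integralT//=; first last.
- by move=> x /=; rewrite /gauss_fun !sqrrN.
- by move=> x; rewrite mulr_ge0 ?sqr_ge0 ?gauss_fun_ge0.
rewrite (_ : [set x : R | _] = `[0, +oo[%classic); last first.
  by apply/seteqP; split => x/=; rewrite in_itv/= andbT.
(* Integration by parts gives this antiderivative of x^2 exp(-x^2). Its limit at infinity is
   sqrt(pi)/4, and symmetry doubles it. *)
pose F (x : R) : R := (integral0_gauss x - x * gauss_fun x) / 2.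
have dI (x : R) : 0 < x ->
    derivable integral0_gauss x 1 /\ derive1 integral0_gauss x = gauss_fun x.
  move=> x0; apply: (@continuous_FTC1 R gauss_fun (BLeft 0) _ (x + 1)) => //.
  - by rewrite ltrDl.
  - exact: integrable_gauss_segment.
  - exact: continuous_gauss_fun.
have dg (x : R) : is_derive x 1 gauss_fun (- 2 * x * gauss_fun x).
  rewrite /gauss_fun; apply: is_derive_eq.
  by rewrite /GRing.scale/=; ring.
have dF (x : R) : 0 < x -> is_derive x 1 F (x ^+ 2 * gauss_fun x).
  move=> x0; have [dI1 dI2] := dI x x0.
  have dI' : is_derive x 1 integral0_gauss (gauss_fun x).
    by rewrite -dI2 derive1E; exact: DeriveDef.
  rewrite /F; apply: is_derive_eq.
  by rewrite /GRing.scale/=; field.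
rewrite (@ge0_continuous_FTC2y R _ F 0 (Num.sqrt pi / 4))//.
- rewrite /F /integral0_gauss set_itv1 Rintegral_set1 mul0r subr0 mul0r.
  rewrite -EFinN -EFinD -EFinM; congr EFin; by field.
- by move=> x _; rewrite mulr_ge0 ?sqr_ge0 ?gauss_fun_ge0.
- exact: continuous_subspaceT.
- rewrite (_ : _ / 4 = (Num.sqrt pi / 2 - 0) / 2); last by field.
  apply: cvgM; last exact: cvg_cst.
  apply: cvgB; first exact: cvg_integral0_gauss.
  exact: cvg_id_mul_gauss_fun.
- by move=> x x0; have [] := dF x x0.
- apply: cvgM; last exact: cvg_cst.
  apply: cvgB.
    rewrite {2}/integral0_gauss set_itv1 Rintegral_set1.
    apply: cvg_at_right_filter.
    apply: (@parameterized_integral_cvg_left R 0 1 gauss_fun) => //.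
    exact: integrable_gauss_segment.
  apply: cvg_at_right_filter; apply: cvgM; first exact: cvg_id.
  exact: continuous_gauss_fun.
- move=> x; rewrite in_itv/= andbT => x0; have [_ <-] := dF x x0.
  by rewrite derive1E.
Qed.

Lemma integral_normal_pdf_moment2 (m s : R) : 0 < s ->
  (\int[mu]_x ((x - m) ^+ 2 * normal_pdf m s x)%:E)%E = (s ^+ 2)%:E.
Proof.
move=> s0; pose r := Num.sqrt (s ^+ 2 *+ 2).
have r0 : 0 < r by rewrite sqrtr_gt0 pmulrn_lgt0// exprn_gt0.
have r2 : r ^+ 2 = s ^+ 2 *+ 2.
  by rewrite sqr_sqrtr// mulrn_wge0// sqr_ge0.
pose F (x : R) : R := (x - m) / r.
have dF (x : R) : is_derive x 1 F r^-1.
  by rewrite /F; apply: is_derive_eq; rewrite /GRing.scale/=; ring.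
have F'E : F^`()%classic = cst r^-1.
  by apply/funext => x; have [_ <-] := dF x; rewrite derive1E.
pose G (x : R) : R := x ^+ 2 * gauss_fun x.
have cG : continuous G.
  by move=> x; apply: cvgM; [exact: exprn_continuous|exact: continuous_gauss_fun].
have G0 (x : R) : 0 <= G x by rewrite mulr_ge0 ?sqr_ge0 ?gauss_fun_ge0.
have := integral_gauss_fun_moment2.
rewrite (@increasing_ge0_integration_by_substitutionT _ F)//; first last.
- apply/gt0_cvgMly; last exact: cvg_addrr.
  by rewrite invr_gt0.
- apply/gt0_cvgMlNy; last exact: cvg_addrr_Ny.
  by rewrite invr_gt0.
- by rewrite F'E; exact: is_cvg_cst.
- by rewrite F'E; exact: is_cvg_cst.
- by rewrite F'E => ?; exact: cvg_cst.
- by move=> x y xy; rewrite /F ltr_pM2r ?invr_gt0// ltrD2r.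
(* With r = s sqrt(2), two of the factors r rescale the square and the third cancels the Jacobian
   1/r. *)
have E (x : R) : (x - m) ^+ 2 * normal_pdf m s x =
    r ^+ 3 * normal_peak s * ((G \o F) * F^`()%classic) x.
  rewrite F'E !fctE /= /G /gauss_fun normal_pdfE ?gt_eqF//= /normal_fun.
  rewrite -r2 /F mulNr expr_div_n; by field; rewrite gt_eqF.
move=> H; under eq_integral do rewrite E EFinM.
rewrite ge0_integralZl//=.
- rewrite H -EFinM; congr EFin.
  rewrite /normal_peak -[s ^+ 2 * pi]mulrC -mulrnAr -r2 sqrtrM ?pi_ge0// sqrtr_sqr.
  rewrite gtr0_norm//.
  have p0 : Num.sqrt pi != 0 :> R by rewrite gt_eqF// sqrtr_gt0 pi_gt0.
  rewrite (_ : s ^+ 2 = r ^+ 2 / 2); last by rewrite r2; by field.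
  by field; rewrite p0 gt_eqF.
- apply/measurable_EFinP; rewrite F'E; apply: continuous_measurable_fun => x.
  apply: cvgM; last exact: cvg_cst.
  apply: (cvg_comp F G); last exact: cG.
  by apply: cvgM; [apply: cvgB; [exact: cvg_id|exact: cvg_cst]|exact: cvg_cst].
- move=> x _; rewrite lee_fin F'E !fctE mulr_ge0// ?G0// invr_ge0 ltW//.
- by rewrite lee_fin mulr_ge0 ?exprn_ge0 ?ltW// normal_peak_gt0// gt_eqF.
Qed.

(** The Radon-Nikodym derivative of the normal law has the same integral as [normal_pdf] over every
    measurable set, hence equals it almost everywhere. *)
Lemma ge0_integral_normal_prob (m s : R) (f : R -> R) :
  (forall x, 0 <= f x) -> measurable_fun [set: R] f ->
  (\int[normal_prob m s]_x (f x)%:E = \int[mu]_x (f x * normal_pdf m s x)%:E)%E.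
Proof.
move=> f0 mf.
have nd := normal_prob_dominates m s.
have mEf : measurable_fun [set: R] (EFin \o f) by exact/measurable_EFinP.
rewrite -(Radon_Nikodym_SigmaFinite.change_of_variables nd)//.
under [RHS]eq_integral do rewrite EFinM.
apply: ge0_ae_eq_integral => //.
- apply: emeasurable_funM => //.
  exact: measurable_int (Radon_Nikodym_SigmaFinite.f_integrable nd).
- apply: emeasurable_funM => //; apply/measurable_EFinP.
  exact: measurable_normal_pdf.
- by move=> x _; rewrite mule_ge0 ?lee_fin// Radon_Nikodym_SigmaFinite.f_ge0.
- by move=> x _; rewrite -EFinM lee_fin mulr_ge0 ?normal_pdf_ge0.
have : ae_eq mu setT (Radon_Nikodym_SigmaFinite.f (normal_prob m s) mu)
    (EFin \o normal_pdf m s).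
  apply: integral_ae_eq => //.
  - exact: Radon_Nikodym_SigmaFinite.f_integrable.
  - by apply/measurable_EFinP; exact: measurable_normal_pdf.
  - by move=> E _ mE; rewrite -Radon_Nikodym_SigmaFinite.f_integral.
by apply: filterS => x /= H _; rewrite H.
Qed.

Lemma ge0_integralN (f : R -> R) :
  (forall x, 0 <= f x) -> measurable_fun [set: R] f ->
  (\int[mu]_x (f (- x))%:E = \int[mu]_x (f x)%:E)%E.
Proof.
move=> f0 mf.
transitivity (\int[pushforward mu (-%R : measurableTypeR R -> measurableTypeR R)]_x (f x)%:E)%E.
  rewrite ge0_integral_pushforward//; first exact/measurable_EFinP.
  by move=> x _; rewrite lee_fin.
apply: eq_measure_integral => A mA _; exact: lebesgue_measureN.
Qed.

End GaussMoment.

(** * Independent random variables *)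

Section Independence.
Context d (T : measurableType d) (R : realType) (P : probability T R).

Lemma measure_eq_on_rectangles d1 d2 (T1 : measurableType d1)
    (T2 : measurableType d2) (m1 m2 : {measure set (T1 * T2) -> \bar R}) :
  (m1 setT < +oo)%E ->
  (forall A B, measurable A -> measurable B -> m1 (A `*` B) = m2 (A `*` B)) ->
  forall C, measurable C -> m1 C = m2 C.
Proof.
move=> m1oo m12.
pose M : set (set (T1 * T2)) := [set A `*` B | A in measurable & B in measurable].
apply: (measure_unique M (fun=> setT)).
- exact: measurable_prod_measurableType.
- move=> _ _ [A mA [B mB <-]] [A' mA' [B' mB' <-]].
  exists (A `&` A'); first exact: measurableI.
  by exists (B `&` B'); [exact: measurableI|rewrite setXI].
- by move=> _; exists setT => //; exists setT => //; rewrite setXTT.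
- by rewrite bigcup_const//; exists 0.
- by move=> _ [A mA [B mB <-]]; exact: m12.
- by [].
Qed.

Definition independent d1 d2 (T1 : measurableType d1) (T2 : measurableType d2)
    (U : T -> T1) (V : T -> T2) :=
  forall A B, measurable A -> measurable B ->
    P ((U @^-1` A) `&` (V @^-1` B)) = (P (U @^-1` A) * P (V @^-1` B))%E.

(** Independence says that the law of the pair agrees with the product of the laws on rectangles,
    hence everywhere. Tonelli then gives integrability of the product and Fubini its value. *)
Lemma independent_integralM (U V : T -> R) :
  measurable_fun setT U -> measurable_fun setT V ->
  P.-integrable setT (EFin \o U) -> P.-integrable setT (EFin \o V) ->
  independent U V ->
  P.-integrable setT (fun w => (U w * V w)%:E) /\
  \int[P]_w (U w * V w) = \int[P]_w U w * \int[P]_w V w.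
Proof.
move=> mU mV iU iV UV.
pose U' : {RV P >-> R} := HB.pack U (isMeasurableFun.Build _ _ _ _ U mU).
pose V' : {RV P >-> R} := HB.pack V (isMeasurableFun.Build _ _ _ _ V mV).
pose m1 := distribution P U'.
pose m2 := distribution P V'.
have mUV : measurable_fun setT (fun w => (U w, V w)) by exact: measurable_fun_pair.
pose UV' : {RV P >-> (R * R)%type} := HB.pack (fun w => (U w, V w))
  (isMeasurableFun.Build _ _ _ _ (fun w => (U w, V w)) mUV).
have DE C : measurable C -> (m1 \x m2)%E C = distribution P UV' C.
  apply: product_measure_unique => A B mA mB /=.
  by rewrite -UV.
have mM : measurable_fun setT (fun z : R * R => (z.1 * z.2)%:E).
  by apply/measurable_EFinP; apply: measurable_funM.
have absE (W : {RV P >-> R}) : (\int[distribution P W]_x `|x|%:E = \int[P]_w `|W w|%:E)%E.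
  rewrite (ge0_integral_distribution W (f := fun x : R => `|x|%:E))//.
  by apply/measurable_EFinP; exact: normr_measurable.
have idI (W : {RV P >-> R}) : P.-integrable setT (EFin \o W) ->
    (distribution P W).-integrable setT EFin.
  move=> /integrableP[_ iW]; apply/integrableP; split => //.
  by rewrite /= absE.
have iD : (m1 \x m2)%E.-integrable setT (fun z : R * R => (z.1 * z.2)%:E).
  apply/integrable12ltyP => //=.
  under eq_integral.
    move=> x _; under eq_integral do rewrite normrM EFinM.
    rewrite ge0_integralZl//; last exact: measurableT_comp.
    over.
  rewrite ge0_integralZr//=; last 2 first.
  - exact: measurableT_comp.
  - exact: integral_ge0.
  rewrite !absE.
  move/integrableP : iU => [_ iU]; move/integrableP : iV => [_ iV].
  by rewrite lte_mul_pinfty// ?integral_ge0// ge0_fin_numE// integral_ge0.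
have iUV : P.-integrable setT (fun w => (U w * V w)%:E).
  apply/integrableP; split.
    by apply/measurable_EFinP; exact: measurable_funM.
  move/integrableP : iD => [_]; apply: le_lt_trans.
  rewrite (eq_measure_integral (distribution P UV')); last by move=> *; exact: DE.
  by rewrite ge0_integral_distribution//; apply: measurableT_comp.
split => //; rewrite /Rintegral.
rewrite -fineM; [|exact: integrable_fin_num|exact: integrable_fin_num].
congr fine.
transitivity (\int[distribution P UV']_z (z.1 * z.2)%:E)%E.
  by rewrite integral_distribution.
rewrite (eq_measure_integral (m1 \x m2)%E) => [|A mA _]; last exact/esym/DE.
rewrite -integral12_prod_meas1// /fubini_F/=.
have fE (W : {RV P >-> R}) : P.-integrable setT (EFin \o W) ->
    (\int[distribution P W]_x x%:E = \int[P]_w (W w)%:E)%E.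
  by move=> iW; rewrite integral_distribution.
have cE : (\int[m2]_y y%:E = (fine (\int[P]_w (V w)%:E))%:E)%E.
  by rewrite fineK ?fE//; exact: integrable_fin_num.
rewrite -[X in _ = (_ * X)%E]fineK; last exact: integrable_fin_num.
under eq_integral.
  move=> x _; under eq_integral do rewrite EFinM.
  rewrite integralZl//; last exact: idI.
  rewrite [X in (_ * X)%E]cE.
  over.
by rewrite integralZr//= ?fE//; exact: idI.
Qed.

Lemma independent_comp d1 d2 d3 d4 (T1 : measurableType d1)
    (T2 : measurableType d2) (T3 : measurableType d3) (T4 : measurableType d4)
    (U : T -> T1) (V : T -> T2) (f : T1 -> T3) (g : T2 -> T4) :
  measurable_fun setT f -> measurable_fun setT g ->
  independent U V -> independent (f \o U) (g \o V).
Proof.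
move=> mf mg UV A B mA mB; apply: (UV (f @^-1` A) (g @^-1` B)).
- by rewrite -[_ @^-1` _]setTI; exact: mf.
- by rewrite -[_ @^-1` _]setTI; exact: mg.
Qed.

(** As functions of [C], both sides are finite measures: the law of the pair restricted to [E], and
    that law scaled by P(E). They agree on rectangles, a generating class stable under
    intersection. *)
Lemma independent_pair_event d1 d2 (T1 : measurableType d1)
    (T2 : measurableType d2) (U : T -> T1) (V : T -> T2) (E : set T) :
  measurable_fun setT U -> measurable_fun setT V -> measurable E ->
  (forall A B, measurable A -> measurable B ->
    P ((U @^-1` A `&` V @^-1` B) `&` E) = (P (U @^-1` A `&` V @^-1` B) * P E)%E) ->
  forall C, measurable C ->
    P ((fun w => (U w, V w)) @^-1` C `&` E) =
    (P ((fun w => (U w, V w)) @^-1` C) * P E)%E.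
Proof.
move=> mU mV mE UVE C mC.
have mUV : measurable_fun setT (fun w => (U w, V w)) by exact: measurable_fun_pair.
pose UV : {mfun T >-> (T1 * T2)%type} := HB.pack (fun w => (U w, V w))
  (isMeasurableFun.Build _ _ _ _ (fun w => (U w, V w)) mUV).
pose m1 : {measure set (T1 * T2) -> \bar R} := pushforward (mrestr P mE) UV.
have PE0 : 0 <= fine (P E) by exact: fine_ge0.
pose m2 : {measure set (T1 * T2) -> \bar R} :=
  mscale (NngNum PE0) (pushforward P UV).
suff : m1 mUV C = m2 mUV C by rewrite /m1 /m2 /= /mscale/= fineK ?fin_num_measure// muleC.
apply: measure_eq_on_rectangles => //.
- rewrite /m1/= /pushforward /mrestr preimage_setT setTI.
  by rewrite (le_lt_trans (probability_le1 _ _))// ltry.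
- move=> A B mA mB; rewrite /m1 /m2 /mscale/= /pushforward /mrestr.
  by rewrite [RHS]muleC fineK ?fin_num_measure//; exact: UVE.
Qed.

Lemma independent_pair d1 d2 d3 d4 (T1 : measurableType d1)
    (T2 : measurableType d2) (T3 : measurableType d3) (T4 : measurableType d4)
    (U1 : T -> T1) (U2 : T -> T2) (V1 : T -> T3) (V2 : T -> T4) :
  measurable_fun setT U1 -> measurable_fun setT U2 ->
  measurable_fun setT V1 -> measurable_fun setT V2 ->
  (forall A1 A2 B1 B2,
    measurable A1 -> measurable A2 -> measurable B1 -> measurable B2 ->
    P ((U1 @^-1` A1 `&` U2 @^-1` A2) `&` (V1 @^-1` B1 `&` V2 @^-1` B2)) =
    (P (U1 @^-1` A1 `&` U2 @^-1` A2) * P (V1 @^-1` B1 `&` V2 @^-1` B2))%E) ->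
  independent (fun w => (U1 w, U2 w)) (fun w => (V1 w, V2 w)).
Proof.
move=> mU1 mU2 mV1 mV2 H A B mA mB.
have mpre d' (T' : measurableType d') (f : T -> T') C :
    measurable_fun setT f -> measurable C -> measurable (f @^-1` C).
  by move=> mf mC; rewrite -[_ @^-1` _]setTI; exact: mf.
(* Rectangles are replaced by arbitrary measurable sets on one side at a time, the other side
   serving as the fixed event. *)
rewrite setIC muleC; apply: independent_pair_event => //.
  by apply: mpre => //; exact: measurable_fun_pair.
move=> B1 B2 mB1 mB2; rewrite setIC muleC.
apply: independent_pair_event => //.
  by apply: measurableI; exact: mpre.
by move=> A1 A2 mA1 mA2; exact: H.
Qed.

End Independence.

(** * Moments of a normal noise coordinate *)

Section NoiseMoments.
Context d (T : measurableType d) (R : realType) (P : probability T R).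
Local Notation mu := (@lebesgue_measure R).

Lemma integrableM_square (U V : T -> R) :
  measurable_fun setT U -> measurable_fun setT V ->
  P.-integrable setT (fun w => (U w ^+ 2)%:E) ->
  P.-integrable setT (fun w => (V w ^+ 2)%:E) ->
  P.-integrable setT (fun w => (U w * V w)%:E).
Proof.
move=> mU mV iU iV.
apply: (le_integrable measurableT _ _ (integrableD measurableT iU iV)).
  by apply/measurable_EFinP; exact: measurable_funM.
move=> w _ /=; rewrite lee_fin [leRHS]ger0_norm ?addr_ge0 ?sqr_ge0// ler_norml.
have := sqr_ge0 (U w + V w); have := sqr_ge0 (U w - V w).
have := sqr_ge0 (U w); have := sqr_ge0 (V w).
by move=> *; apply/andP; split; nra.
Qed.

Variables (n : T -> R) (s : R).
Hypothesis mn : measurable_fun setT n.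
Hypothesis s0 : 0 < s.
Hypothesis n_law : forall B : set R, measurable B ->
  P [set w | B (n w)] = normal_prob 0 s B.

Lemma ge0_integral_normal_law (f : R -> R) :
  (forall x, 0 <= f x) -> measurable_fun setT f ->
  (\int[P]_w (f (n w))%:E = \int[mu]_x (f x * normal_pdf 0 s x)%:E)%E.
Proof.
move=> f0 mf.
have mn' : measurable_fun setT (n : T -> measurableTypeR R) := mn.
pose n' : {RV P >-> measurableTypeR R} :=
  HB.pack (n : T -> measurableTypeR R) (isMeasurableFun.Build _ _ _ _ _ mn').
rewrite -ge0_integral_normal_prob//.
rewrite -(ge0_integral_distribution n' (f := fun x : measurableTypeR R => (f x)%:E))//.
- by apply: eq_measure_integral => A mA _; exact: n_law.
- exact/measurable_EFinP.
Qed.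

Lemma normal_law_moment2 :
  P.-integrable setT (fun w => (n w ^+ 2)%:E) /\ \int[P]_w (n w ^+ 2) = s ^+ 2.
Proof.
have E : (\int[P]_w (n w ^+ 2)%:E = (s ^+ 2)%:E)%E.
  rewrite (ge0_integral_normal_law (f := fun x => x ^+ 2)).
  - rewrite -(integral_normal_pdf_moment2 0 s0).
    by apply: eq_integral => x _; rewrite subr0.
  - by move=> x; exact: sqr_ge0.
  - exact: exprn_measurable.
split; last by rewrite /Rintegral E.
apply/integrableP; split; first by apply/measurable_EFinP; exact: measurable_funX.
by under eq_integral do rewrite /= ger0_norm ?sqr_ge0//; rewrite E ltry.
Qed.

Lemma normal_law_mean :
  P.-integrable setT (fun w => (n w)%:E) /\ \int[P]_w n w = 0.
Proof.
have [i2 _] := normal_law_moment2.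
have i1 : P.-integrable setT (fun w => (n w)%:E).
  have i0 : P.-integrable setT (fun w => ((1 : R) ^+ 2)%:E).
    exact: finite_measure_integrable_cst.
  have := integrableM_square mn (measurable_cst (1 : R)) i2 i0.
  by under eq_fun do rewrite mulr1.
split => //.
have mx (f : R -> R) : measurable_fun setT f -> measurable_fun setT (fun x => Num.max (f x) 0).
  by move=> mf; apply: measurable_maxr.
have x0 (f : R -> R) x : 0 <= Num.max (f x) 0 by rewrite le_max lexx orbT.
have mo : measurable_fun [set: R] (-%R : R -> R) by exact: oppr_measurable.
(* The density is even, so the positive and the negative part have equal integrals. Splitting into
   parts keeps every integrand nonnegative, as the change of variables requires. *)
have E : (\int[P]_w (Num.max (n w) 0)%:E = \int[P]_w (Num.max (- n w) 0)%:E)%E.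
  rewrite (ge0_integral_normal_law (x0 id) (mx id (@measurable_id _ _ _))).
  rewrite (ge0_integral_normal_law (x0 -%R) (mx -%R mo)).
  rewrite -ge0_integralN.
  - apply: eq_integral => x _; congr (_ * _)%:E.
    by rewrite !normal_pdfE ?gt_eqF// /normal_fun !subr0 sqrrN.
  - by move=> x; rewrite mulr_ge0 ?(x0 id)// normal_pdf_ge0.
  - by apply: measurable_funM; [exact: (mx id)|exact: measurable_normal_pdf].
have ip (f : R -> R) : measurable_fun setT f -> (forall x, `|f x| <= `|x|) ->
    P.-integrable setT (EFin \o (fun w => f (n w))).
  move=> mf lef; apply: (le_integrable measurableT _ _ i1) => //.
    by apply/measurable_EFinP; exact: measurableT_comp.
  by move=> w _ /=; rewrite lee_fin.
have i1p := ip (fun x => Num.max x 0) (mx id (@measurable_id _ _ _)) _.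
have i1m := ip (fun x => Num.max (- x) 0) (mx -%R _) _.
rewrite (@eq_Rintegral _ _ _ _ _ (fun w => Num.max (n w) 0 - Num.max (- n w) 0)); last first.
  by move=> w _; case: (ltrP (n w) 0) => h; case: (ltrP (- n w) 0) => h'; lra.
rewrite RintegralB//.
- by rewrite /Rintegral E subrr.
- by apply: i1p => x; case: (ltrP x 0) => h; rewrite ?normr0.
- apply: i1m; first exact: oppr_measurable.
  by move=> x; case: (ltrP (- x) 0) => h; rewrite ?normr0 ?normrN.
Qed.

End NoiseMoments.

Section RintegralSum.
Context d (T : measurableType d) (R : realType) (mu : {measure set T -> \bar R}).

Lemma integrable_sumR (I : Type) (s : seq I) (f : I -> T -> R) :
  (forall i, mu.-integrable setT (fun x => (f i x)%:E)) ->
  mu.-integrable setT (fun x => (\sum_(i <- s) f i x)%:E).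
Proof.
move=> fi; apply: (eq_integrable measurableT (fun x => \sum_(i <- s) (f i x)%:E)%E).
  by move=> x _; rewrite sumEFin.
by apply: integrable_sum => // i _; exact: fi.
Qed.

Lemma Rintegral_sum (I : Type) (s : seq I) (f : I -> T -> R) :
  (forall i, mu.-integrable setT (fun x => (f i x)%:E)) ->
  \int[mu]_x (\sum_(i <- s) f i x) = \sum_(i <- s) \int[mu]_x f i x.
Proof.
move=> fi; elim: s => [|i s ih].
  rewrite big_nil (@eq_Rintegral _ _ _ _ _ (fun=> 0)); last first.
    by move=> x _; rewrite big_nil.
  by rewrite Rintegral_cst// mul0r.
rewrite big_cons -ih -RintegralD//; [|exact: fi|exact: integrable_sumR].
by apply: eq_Rintegral => x _; rewrite big_cons.
Qed.

Lemma integrableZlR (c : R) (f : T -> R) :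
  mu.-integrable setT (fun x => (f x)%:E) ->
  mu.-integrable setT (fun x => (c * f x)%:E).
Proof. by move=> fi; under eq_fun do rewrite EFinM; exact: integrableZl. Qed.

End RintegralSum.

(** * Mixed moments of signal and noise coordinates *)

Section SignalNoise.
Context {R : realType} {d : measure_display} {T : measurableType d}.
Context (P : probability T R) (Nt Nr L : nat).
Variables (W : 'M[R[i]]_Nt) (X : T -> 'M[R[i]]_(Nt, L)) (N : T -> 'M[R[i]]_(Nr, L)).
Variable sigma : R.
Hypothesis sigma0 : 0 < sigma.
Hypothesis HX : transmit_signal P W X.
Hypothesis HN : awgn P sigma X N.
Local Notation I := ('I_Nt * 'I_L * bool)%type.
Local Notation J := ('I_Nr * 'I_L * bool)%type.
Local Notation x k := (fun w => rcoord (X w) k).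
Local Notation n k := (fun w => rcoord (N w) k).

Let mx k : measurable_fun setT (x k). Proof. by case: HX. Qed.
Let mn k : measurable_fun setT (n k). Proof. by case: HN. Qed.

Let s := sigma / Num.sqrt 2.
Let s0 : 0 < s. Proof. by rewrite divr_gt0// sqrtr_gt0. Qed.
Let s2 : s ^+ 2 = sigma ^+ 2 / 2.
Proof. by rewrite /s expr_div_n sqr_sqrtr. Qed.

Let n_law k (B : set R) : measurable B -> P [set w | B (rcoord (N w) k)] = normal_prob 0 s B.
Proof. by case: HN => _ + _; apply. Qed.

Lemma integrable_signalM j j' :
  P.-integrable setT (fun w => (rcoord (X w) j * rcoord (X w) j')%:E).
Proof. by case: HX => _ h _; apply: integrableM_square; rewrite ?mx. Qed.

(* Brings an event on two coordinates into the form required by the product rule of [awgn]. *)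
Let two_events (K : finType) (f : K -> T -> R) k k' (B B' : set R) :
  measurable B -> measurable B' ->
  exists C : K -> set R, [/\ forall k, measurable (C k),
    f k @^-1` B `&` f k' @^-1` B' = [set w | forall k, C k (f k w)],
    k != k' -> C k = B /\ C k' = B' &
    forall l, l != k -> l != k' -> C l = setT].
Proof.
move=> mB mB'.
(* The intersection also covers k = k', where both constraints fall on the same coordinate. *)
exists (fun l => (if l == k then B else setT) `&` (if l == k' then B' else setT)).
split.
- by move=> l; apply: measurableI; case: ifP.
- apply/seteqP; split => [w [/= Bk Bk'] l|w /= h].
    by split; case: eqP => // ->.
  by split; [have [+ _] := h k|have [_ +] := h k']; rewrite eqxx.
- by move=> kk'; rewrite !eqxx [k' == k]eq_sym (negbTE kk') setIT setTI.
- by move=> l /negbTE -> /negbTE ->; rewrite setIT.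
Qed.

Let noise_prod (B : J -> set R) : (forall k, measurable (B k)) ->
  P [set w | forall k, B k (rcoord (N w) k)] =
  (\prod_k P [set w | B k (rcoord (N w) k)])%E.
Proof.
move=> mB; case: HN => _ _ /(_ (fun=> setT) B (fun=> measurableT) mB).
have -> : [set w | forall k : I, setT (rcoord (X w) k)] = setT by apply/seteqP.
by rewrite setTI probability_setT mul1e.
Qed.

Lemma noise_independent k k' : k != k' -> independent P (n k) (n k').
Proof.
move=> kk' B B' mB mB'.
have [C [mC -> /(_ kk')[Ck Ck'] CT]] := two_events (fun k => n k) k k' mB mB'.
rewrite noise_prod// (bigD1 k)//= (bigD1 k')//=; last by rewrite eq_sym.
rewrite Ck Ck' big1 ?mule1// => l /andP[lk lk']; rewrite CT//.
by rewrite -(@probability_setT _ _ _ P); congr (P _); apply/seteqP.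
Qed.

(** A product of two coordinates is a function of a pair, so independence of the pairs suffices, and
    that is checked on boxes, where the product rule of [awgn] applies. *)
Lemma signal_noise_independent j j' k k' :
  independent P (fun w => rcoord (X w) j * rcoord (X w) j')
    (fun w => rcoord (N w) k * rcoord (N w) k').
Proof.
apply: (independent_comp (U := fun w => (x j w, x j' w)) (V := fun w => (n k w, n k' w))
  (f := fun z : R * R => z.1 * z.2) (g := fun z : R * R => z.1 * z.2)).
- exact: measurable_funM.
- exact: measurable_funM.
apply: independent_pair => // A1 A2 B1 B2 mA1 mA2 mB1 mB2.
have [A [mA -> _ _]] := two_events (fun k => x k) j j' mA1 mA2.
have [B [mB -> _ _]] := two_events (fun k => n k) k k' mB1 mB2.
by rewrite noise_prod//; case: HN => _ _; apply.
Qed.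

Lemma noise_moment k k' :
  P.-integrable setT (fun w => (rcoord (N w) k * rcoord (N w) k')%:E) /\
  \int[P]_w (rcoord (N w) k * rcoord (N w) k') = (k == k')%:R * (sigma ^+ 2 / 2).
Proof.
have [<-|kk'] := eqVneq k k'.
  have [i2 e2] := normal_law_moment2 (mn k) s0 (n_law k).
  by rewrite mul1r -s2 -e2; split.
have [ik ek] := normal_law_mean (mn k) s0 (n_law k).
have [ik' ek'] := normal_law_mean (mn k') s0 (n_law k').
have [-> ->] := independent_integralM (mn k) (mn k') ik ik' (noise_independent kk').
by rewrite ek !mul0r.
Qed.

Lemma signal_noise_moment j j' k k' :
  P.-integrable setT (fun w => ((rcoord (X w) j * rcoord (X w) j') *
                                (rcoord (N w) k * rcoord (N w) k'))%:E) /\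
  \int[P]_w ((rcoord (X w) j * rcoord (X w) j') *
             (rcoord (N w) k * rcoord (N w) k')) =
  \int[P]_w (rcoord (X w) j * rcoord (X w) j') * ((k == k')%:R * (sigma ^+ 2 / 2)).
Proof.
have [ik ek] := noise_moment k k'.
rewrite -ek; apply: independent_integralM => //.
- exact: measurable_funM.
- exact: measurable_funM.
- exact: integrable_signalM.
- exact: signal_noise_independent.
Qed.

(** Expanded, every term is a signal product times a noise product. Independence separates the two,
    and the noise covariance (sigma^2 / 2) times the identity leaves only the diagonal k = k'. The
    coefficients [c] and [c'] will describe two score coordinates. *)
Lemma bilinear_signal_noise_moment (c c' : J -> I -> R) :
  P.-integrable setT (fun w =>
    ((\sum_k (\sum_j c k j * rcoord (X w) j) * rcoord (N w) k) *
     (\sum_k (\sum_j c' k j * rcoord (X w) j) * rcoord (N w) k))%:E) /\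
  \int[P]_w ((\sum_k (\sum_j c k j * rcoord (X w) j) * rcoord (N w) k) *
             (\sum_k (\sum_j c' k j * rcoord (X w) j) * rcoord (N w) k)) =
  sigma ^+ 2 / 2 * \int[P]_w \sum_k
    ((\sum_j c k j * rcoord (X w) j) * (\sum_j c' k j * rcoord (X w) j)).
Proof.
have iXX k k' : P.-integrable setT (fun w => ((\sum_j c k j * rcoord (X w) j) *
                                     (\sum_j c' k' j * rcoord (X w) j))%:E).
  under eq_fun.
    move=> w; rewrite big_distrl/=.
    under eq_bigr do rewrite big_distrr/=.
    under eq_bigr do under eq_bigr do rewrite mulrACA.
    over.
  by do 2!(apply: integrable_sumR => ?); exact/integrableZlR/integrable_signalM.
rewrite [in RHS]Rintegral_sum//.
have EX k k' w : (\sum_j c k j * rcoord (X w) j) * rcoord (N w) k *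
   ((\sum_j c' k' j * rcoord (X w) j) * rcoord (N w) k') =
   \sum_j \sum_j' (c k j * c' k' j') * ((rcoord (X w) j * rcoord (X w) j') *
                                (rcoord (N w) k * rcoord (N w) k')).
  rewrite mulrACA big_distrl/= big_distrl/=; apply: eq_bigr => j _.
  rewrite big_distrr/= big_distrl/=; apply: eq_bigr => j' _.
  by ring.
have iall k k' : P.-integrable setT (fun w => ((\sum_j c k j * rcoord (X w) j) * rcoord (N w) k *
   ((\sum_j c' k' j * rcoord (X w) j) * rcoord (N w) k'))%:E).
  under eq_fun do rewrite EX.
  do 2!(apply: integrable_sumR => ?); apply: integrableZlR.
  exact: (signal_noise_moment _ _ _ _).1.
split.
  under eq_fun.
    move=> w; rewrite big_distrl/=; under eq_bigr do rewrite big_distrr/=.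
    over.
  by do 2!(apply: integrable_sumR => ?).
under eq_Rintegral => w _.
  rewrite big_distrl/=; under eq_bigr do rewrite big_distrr/=.
  over.
rewrite Rintegral_sum; last by move=> k; exact: integrable_sumR.
rewrite big_distrr/=; apply: eq_bigr => k _.
rewrite Rintegral_sum//.
have key k' : \int[P]_w ((\sum_j c k j * rcoord (X w) j) * rcoord (N w) k *
   ((\sum_j c' k' j * rcoord (X w) j) * rcoord (N w) k')) =
   ((k == k')%:R * (sigma ^+ 2 / 2)) * \int[P]_w
    ((\sum_j c k j * rcoord (X w) j) * (\sum_j c' k' j * rcoord (X w) j)).
  under eq_Rintegral do rewrite EX.
  rewrite Rintegral_sum => [|j]; last first.
    apply: integrable_sumR => ?; apply: integrableZlR.
    exact: (signal_noise_moment _ _ _ _).1.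
  under [in RHS]eq_Rintegral.
    move=> w _; rewrite big_distrl/=.
    under eq_bigr do rewrite big_distrr/=.
    under eq_bigr do under eq_bigr do rewrite mulrACA.
    over.
  rewrite [in RHS]Rintegral_sum => [|j]; last first.
    by apply: integrable_sumR => ?; exact/integrableZlR/integrable_signalM.
  rewrite big_distrr/=; apply: eq_bigr => j _.
  rewrite Rintegral_sum => [|j']; last first.
    by apply: integrableZlR; exact: (signal_noise_moment _ _ _ _).1.
  rewrite [in RHS]Rintegral_sum => [|j']; last first.
    exact/integrableZlR/integrable_signalM.
  rewrite big_distrr/=; apply: eq_bigr => j' _.
  have [ia ea] := signal_noise_moment j j' k k'.
  rewrite RintegralZl// ea RintegralZl//; last exact: integrable_signalM.
  by ring.
rewrite (bigD1 k)//= key eqxx mul1r big1 ?addr0// => k' kk'.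
by rewrite key eq_sym (negbTE kk') !mul0r.
Qed.

End SignalNoise.

(** * Complex matrices of a real variable *)

Section ComplexParts.
Context {R : realType}.
Implicit Types x y z : R[i].

Lemma ReD x y : complex.Re (x + y) = complex.Re x + complex.Re y.
Proof. by case: x; case: y. Qed.

Lemma ImD x y : complex.Im (x + y) = complex.Im x + complex.Im y.
Proof. by case: x; case: y. Qed.

Lemma ReM x y : complex.Re (x * y) =
  complex.Re x * complex.Re y - complex.Im x * complex.Im y.
Proof. by case: x; case: y. Qed.

Lemma ImM x y : complex.Im (x * y) =
  complex.Re x * complex.Im y + complex.Im x * complex.Re y.
Proof. by case: x => a b; case: y => c e /=; rewrite addrC. Qed.

Lemma Re_sum (I : Type) (s : seq I) (p : pred I) (f : I -> R[i]) :
  complex.Re (\sum_(i <- s | p i) f i) = \sum_(i <- s | p i) complex.Re (f i).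
Proof. exact: (big_morph _ ReD (erefl _)). Qed.

Lemma Im_sum (I : Type) (s : seq I) (p : pred I) (f : I -> R[i]) :
  complex.Im (\sum_(i <- s | p i) f i) = \sum_(i <- s | p i) complex.Im (f i).
Proof. exact: (big_morph _ ImD (erefl _)). Qed.

Lemma Re_conj z : complex.Re (conjc z) = complex.Re z. Proof. by case: z. Qed.
Lemma Im_conj z : complex.Im (conjc z) = - complex.Im z. Proof. by case: z. Qed.

Lemma complexP x y :
  complex.Re x = complex.Re y -> complex.Im x = complex.Im y -> x = y.
Proof. by case: x; case: y => /= a b c e -> ->. Qed.

Lemma conj_mulE z : conjc z * z = (sqmod z)%:C.
Proof. by case: z => a b; apply: complexP; rewrite /sqmod /=; ring. Qed.

Lemma Re_realM (x : R) z : complex.Re (x%:C * z) = x * complex.Re z.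
Proof. by rewrite ReM /= mul0r subr0. Qed.

Lemma Im_realM (x : R) z : complex.Im (x%:C * z) = x * complex.Im z.
Proof. by rewrite ImM /= mul0r addr0. Qed.

Lemma Re_iM z : complex.Re ('i * z) = - complex.Im z.
Proof. by rewrite ReM /= mul0r mul1r sub0r. Qed.

Lemma sqmod_conjM y z : sqmod (conjc y * z) = sqmod y * sqmod z.
Proof. by case: y => a b; case: z => c e; rewrite /sqmod /=; ring. Qed.

Lemma sqmod_ge0 z : 0 <= sqmod z.
Proof. by rewrite addr_ge0 ?sqr_ge0. Qed.

Lemma sqmod_gt0 z : z != 0 -> 0 < sqmod z.
Proof.
move=> z0; rewrite lt_neqAle sqmod_ge0 andbT eq_sym; apply: contra z0.
rewrite /sqmod paddr_eq0 ?sqr_ge0// !sqrf_eq0 => /andP[/eqP a0 /eqP b0].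
by apply/eqP/complexP; rewrite /= ?a0 ?b0.
Qed.

End ComplexParts.

Section ComplexDerivative.
Context {R : realType}.

Lemma is_derive_bigsum (I : Type) (r : seq I) (f : I -> R -> R) (df : I -> R) (t : R) :
  (forall i, is_derive t 1 (f i) (df i)) ->
  is_derive t 1 (fun s => \sum_(i <- r) f i s) (\sum_(i <- r) df i).
Proof.
move=> h; elim: r => [|i r ih].
  rewrite big_nil (_ : (fun _ => _) = cst 0); last first.
    by apply/funext => s; rewrite big_nil.
  exact: is_derive_cst.
rewrite big_cons (_ : (fun _ => _) = f i + (fun s => \sum_(j <- r) f j s)).
  exact: is_deriveD.
by apply/funext => s; rewrite big_cons.
Qed.

Definition cderiv (f : R -> R[i]) (t : R) (l : R[i]) :=
  is_derive t 1 (fun s => complex.Re (f s)) (complex.Re l) /\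
  is_derive t 1 (fun s => complex.Im (f s)) (complex.Im l).

Lemma cderiv_cst c t : cderiv (fun=> c) t 0.
Proof. by split; exact: is_derive_cst. Qed.

Lemma cderivM f g t l m : cderiv f t l -> cderiv g t m ->
  cderiv (fun s => f s * g s) t (l * g t + f t * m).
Proof.
move=> [fr fi] [gr gi]; split.
  under eq_fun do rewrite ReM; apply: is_derive_eq.
  by rewrite ReD !ReM /GRing.scale/=; ring.
under eq_fun do rewrite ImM; apply: is_derive_eq.
by rewrite ImD !ImM /GRing.scale/=; ring.
Qed.

Lemma cderiv_sum (I : Type) (r : seq I) (f : I -> R -> R[i]) (df : I -> R[i]) t :
  (forall i, cderiv (f i) t (df i)) ->
  cderiv (fun s => \sum_(i <- r) f i s) t (\sum_(i <- r) df i).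
Proof.
move=> h; split.
  under eq_fun do rewrite Re_sum; rewrite Re_sum.
  by apply: is_derive_bigsum => i; case: (h i).
under eq_fun do rewrite Im_sum; rewrite Im_sum.
by apply: is_derive_bigsum => i; case: (h i).
Qed.

Lemma cderiv_conj f t l : cderiv f t l -> cderiv (fun s => conjc (f s)) t (conjc l).
Proof.
move=> [fr fi]; split.
  by under eq_fun do rewrite Re_conj; rewrite Re_conj.
by under eq_fun do rewrite Im_conj; rewrite Im_conj; exact: is_deriveN.
Qed.

(** Partial derivatives of the log-likelihood are taken along lines parametrized by [h] at 0, where
    the angle reads h + t. *)
Lemma cderiv_shift f t l : cderiv f t l -> cderiv (fun h => f (h + t)) 0 l.
Proof.
have H (u : R -> R) v : is_derive t 1 u v -> is_derive (0 : R) 1 (fun h => u (h + t)) v.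
  move=> h; have h' : is_derive (0 + t) 1 u v by rewrite add0r.
  have := @is_derive1_comp R u (fun h => h + t) 0 v 1 h' _.
  rewrite mulr1; apply.
  by apply: is_derive_eq; rewrite addr0.
by move=> [fr fi]; split; exact: H.
Qed.

Definition cderivmx m n (F : R -> 'M[R[i]]_(m, n)) t (D : 'M[R[i]]_(m, n)) :=
  forall i j, cderiv (fun s => F s i j) t (D i j).

Lemma derivmx_eq m n (F : R -> 'M[R[i]]_(m, n)) t D :
  cderivmx F t D -> derivmx F t = D.
Proof.
move=> h; apply/matrixP => i j; rewrite mxE; have [[_ hr] [_ hi]] := h i j.
by apply: complexP; rewrite /= derive1E.
Qed.

Lemma cderivmx_cst m n (M : 'M[R[i]]_(m, n)) t : cderivmx (fun=> M) t 0.
Proof. by move=> i j; rewrite mxE; exact: cderiv_cst. Qed.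

Lemma cderivmxM m n p (F : R -> 'M[R[i]]_(m, n)) (G : R -> 'M[R[i]]_(n, p)) t D E :
  cderivmx F t D -> cderivmx G t E ->
  cderivmx (fun s => F s *m G s) t (D *m G t + F t *m E).
Proof.
move=> hF hG i j; rewrite !mxE -big_split/=.
under eq_fun do rewrite mxE.
by apply: cderiv_sum => k; exact: cderivM.
Qed.

Lemma cderivmxZ m n (f : R -> R[i]) (F : R -> 'M[R[i]]_(m, n)) t l D :
  cderiv f t l -> cderivmx F t D ->
  cderivmx (fun s => f s *: F s) t (l *: F t + f t *: D).
Proof.
move=> hf hF i j; rewrite !mxE; under eq_fun do rewrite mxE.
exact: cderivM.
Qed.

Lemma cderivmxH m n (F : R -> 'M[R[i]]_(m, n)) t D :
  cderivmx F t D -> cderivmx (fun s => (F s)^H) t (D^H).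
Proof.
move=> hF i j; rewrite !mxE; under eq_fun do rewrite !mxE.
exact: cderiv_conj.
Qed.

End ComplexDerivative.

Section SteeringDerivative.
Context {R : realType}.
Implicit Types (g : geometry R) (t : R).

Definition phase N g (i : 'I_N) : R :=
  - (pi * spacing g * (N%:R - 2 * i.+1%:R + 1) * cosphi g / wavelength g).

Lemma steeringE N g t i : steering N g t i 0 = expi (phase g i * sin t).
Proof. by rewrite mxE /phase; congr expi; ring. Qed.

Definition dsteering N g t : 'cV[R[i]]_N :=
  \col_i ((0 +i* (phase g i * cos t)) * expi (phase g i * sin t)).

Lemma cderivmx_steering N g t : cderivmx (steering N g) t (dsteering N g t).
Proof.
move=> i j; rewrite ord1 mxE; under eq_fun do rewrite steeringE.
rewrite /expi; split => /=.
  by apply: is_derive_eq; rewrite /GRing.scale/=; ring.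
by apply: is_derive_eq; rewrite /GRing.scale/=; ring.
Qed.

Lemma derivmx_steering N g t : derivmx (steering N g) t = dsteering N g t.
Proof. exact/derivmx_eq/cderivmx_steering. Qed.

End SteeringDerivative.

(** * The score *)

Section RealCoordinates.
Context {R : realType}.

Lemma sum_rcoord m n (F : 'I_m -> 'I_n -> bool -> R) :
  \sum_(k : 'I_m * 'I_n * bool) F k.1.1 k.1.2 k.2 =
  \sum_i \sum_j (F i j true + F i j false).
Proof.
rewrite -(pair_bigA _ (fun p b => F p.1 p.2 b))/=.
rewrite -(pair_bigA _ (fun i j => \sum_b F i j b))/=.
by apply: eq_bigr => i _; apply: eq_bigr => j _; rewrite big_bool.
Qed.

Lemma sum_rcoordM m n (A B : 'M[R[i]]_(m, n)) :
  \sum_k rcoord A k * rcoord B k = complex.Re (\tr (A^H *m B)).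
Proof.
rewrite (sum_rcoord (fun i j b => (if b then complex.Im (A i j) else complex.Re (A i j)) *
  (if b then complex.Im (B i j) else complex.Re (B i j)))) /= /mxtrace.
rewrite Re_sum exchange_big/=; apply: eq_bigr => j _.
rewrite mxE Re_sum; apply: eq_bigr => i _.
by rewrite !mxE ReM Re_conj Im_conj; ring.
Qed.

(** A complex-linear map is real-linear in the coordinates, each entry of [M] acting as the block
    [[Re, -Im], [Im, Re]] within one column. The coefficients do not depend on [A], so one choice
    serves all realizations of the signal. *)
Lemma rcoord_mulmx m n p (M : 'M[R[i]]_(m, n)) : exists c,
  forall (A : 'M[R[i]]_(n, p)) k, rcoord (M *m A) k = \sum_j c k j * rcoord A j.
Proof.
exists (fun k j => (j.1.2 == k.1.2)%:R *
  (if k.2 then if j.2 then complex.Re (M k.1.1 j.1.1) else complex.Im (M k.1.1 j.1.1)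
   else if j.2 then - complex.Im (M k.1.1 j.1.1) else complex.Re (M k.1.1 j.1.1))).
move=> A [[i l] b]; rewrite /rcoord /=.
rewrite (sum_rcoord (fun j l' b' => (l' == l)%:R *
  (if b then if b' then complex.Re (M i j) else complex.Im (M i j)
   else if b' then - complex.Im (M i j) else complex.Re (M i j)) *
  (if b' then complex.Im (A j l') else complex.Re (A j l'))))/=.
have H j : \sum_l' ((l' == l)%:R *
      (if b then complex.Re (M i j) else - complex.Im (M i j)) * complex.Im (A j l') +
      (l' == l)%:R * (if b then complex.Im (M i j) else complex.Re (M i j)) *
      complex.Re (A j l')) =
    if b then complex.Im (M i j * A j l) else complex.Re (M i j * A j l).
  rewrite (bigD1 l)//= eqxx big1 ?addr0 => [|l' /negbTE ->]; last first.
    by rewrite /= !mul0r addr0.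
  by rewrite !mul1r; case: b; rewrite ?ReM ?ImM; ring.
under eq_bigr do rewrite H.
by case: b {H}; rewrite mxE ?Re_sum ?Im_sum.
Qed.

Lemma sqnormB m n (A B : 'M[R[i]]_(m, n)) :
  sqnorm (A - B) = sqnorm A + sqnorm B - 2 * complex.Re (\tr (B^H *m A)).
Proof.
rewrite /sqnorm -big_split /mxtrace Re_sum.
under [X in _ - 2 * X]eq_bigr do rewrite mxE Re_sum.
rewrite [X in _ - 2 * X]exchange_big/= big_distrr/= -sumrN -big_split/=.
apply: eq_bigr => i _; rewrite -big_split/= big_distrr/= -sumrN -big_split/=.
apply: eq_bigr => j _; rewrite !mxE /sqmod ReM Re_conj Im_conj.
by case: (A i j) => a b; case: (B i j) => c e /=; ring.
Qed.

End RealCoordinates.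

Lemma derive_along_line (R : realType) (V : normedModType R) (f : V -> R)
    (z v : V) (l : R) :
  is_derive (0 : R) 1 (fun h => f (h *: v + z)) l -> 'D_v f z = l.
Proof.
move=> [_ <-]; rewrite /derive.
set u := (X in lim (X @ _)); set w := (X in _ = lim (X @ _)).
suff -> : u = w by [].
apply/funext => h; rewrite /u /w /= [h *: 1]mulr1.
by rewrite addr0 scale0r add0r.
Qed.

Section Score.
Context {R : realType} (Nt Nr L : nat) (g : geometry R) (sigma : R).
Hypothesis sigma0 : 0 < sigma.
Implicit Types (X : 'M[R[i]]_(Nt, L)) (Y : 'M[R[i]]_(Nr, L)) (z : 'cV[R]_3).
Local Notation a := (steering Nt g).
Local Notation b := (steering Nr g).

Definition channel_at z : 'M[R[i]]_(Nr, Nt) :=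
  channel Nt Nr g (z 1 0 +i* z ord_max 0) (z 0 0).

(** Completing the square. Only the residual [Y - channel_at z *m X] remains, and at the true
    parameter it is the noise. *)
Lemma loglikE X Y z : loglik g sigma X Y z =
  - sqnorm (Y - channel_at z *m X) / sigma ^+ 2
  - (Nr * L)%:R * ln (pi * sigma ^+ 2).
Proof.
rewrite /loglik -/(channel_at z) sqnormB; congr (_ - _).
by rewrite trmx_mul map_mxM/= mulNr; field; rewrite gt_eqF.
Qed.

Lemma derive_loglik X Y z v (D : 'M[R[i]]_(Nr, Nt)) :
  cderivmx (fun h : R => channel_at (h *: v + z)) 0 D ->
  'D_v (loglik g sigma X Y) z =
  2 / sigma ^+ 2 * \sum_k rcoord (D *m X) k * rcoord (Y - channel_at z *m X) k.
Proof.
move=> hD.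
pose G (h : R) := channel_at (h *: v + z) *m X.
have hG : cderivmx G 0 (D *m X).
  by have := cderivmxM hD (cderivmx_cst X 0); rewrite mulmx0 addr0.
have G0 : G 0 = channel_at z *m X by rewrite /G scale0r add0r.
have H : is_derive (0 : R) 1 (fun h => loglik g sigma X Y (h *: v + z))
  (2 / sigma ^+ 2 * \sum_k rcoord (D *m X) k * rcoord (Y - channel_at z *m X) k).
  rewrite sum_rcoordM.
  have E h : loglik g sigma X Y (h *: v + z) =
     (- (sigma ^+ 2)^-1) * (\sum_i \sum_j
       ((complex.Re (Y i j) - complex.Re (G h i j)) ^+ 2 +
        (complex.Im (Y i j) - complex.Im (G h i j)) ^+ 2))
     - (Nr * L)%:R * ln (pi * sigma ^+ 2).
    rewrite loglikE; congr (_ - _); rewrite mulNr mulrC -mulNr; congr (_ * _).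
    apply: eq_bigr => i _; apply: eq_bigr => j _; rewrite -/(G h) /sqmod !mxE.
    by case: (Y i j) => y1 y2; case: (\sum_(_ | _) _).
  under eq_fun do rewrite E.
  have S : is_derive (0 : R) 1 (fun h => \sum_i \sum_j
       ((complex.Re (Y i j) - complex.Re (G h i j)) ^+ 2 +
        (complex.Im (Y i j) - complex.Im (G h i j)) ^+ 2))
     (\sum_i \sum_j (- 2 * (complex.Re ((D *m X) i j) * complex.Re ((Y - G 0) i j) +
        complex.Im ((D *m X) i j) * complex.Im ((Y - G 0) i j)))).
    apply: is_derive_bigsum => i; apply: is_derive_bigsum => j.
    have [hr hi] := hG i j.
    apply: is_derive_eq; rewrite /GRing.scale/=.
    by rewrite !mxE ReD ImD; case: (G 0 i j) => c e /=; ring.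
  apply: is_derive_eq; rewrite -sum_rcoordM G0.
  rewrite (sum_rcoord (fun i j b => (if b then complex.Im ((D *m X) i j) else complex.Re ((D *m X) i j)) *
    (if b then complex.Im ((Y - channel_at z *m X) i j) else complex.Re ((Y - channel_at z *m X) i j)))).
  rewrite subr0; set S2 := (X in _ = _ * X).
  transitivity (- (sigma ^+ 2)^-1 * (- 2 * S2)); last by ring.
  congr (_ * _); rewrite mulr_sumr; apply: eq_bigr => i _.
  by rewrite mulr_sumr; apply: eq_bigr => j _; rewrite addrC.
exact: derive_along_line H.
Qed.

Definition dchannel (alpha : R[i]) (t : R) (i : 'I_3) : 'M[R[i]]_(Nr, Nt) :=
  [:: alpha *: (dsteering Nr g t *m (a t)^H + b t *m (dsteering Nt g t)^H);
      b t *m (a t)^H; 'i *: (b t *m (a t)^H)]`_i.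

Lemma cderivmx_channel alpha t i :
  cderivmx (fun h : R => channel_at (h *: delta_mx i 0 + zeta t alpha)) 0
    (dchannel alpha t i).
Proof.
have Ez (h : R) : channel_at (h *: delta_mx i 0 + zeta t alpha) =
    channel Nt Nr g ((h * (i == 1)%:R + complex.Re alpha) +i*
      (h * (i == ord_max)%:R + complex.Im alpha)) (h * (i == 0)%:R + t).
  by rewrite /channel_at !mxE /= !eqxx !andbT ![_ == i]eq_sym.
rewrite (funext Ez) /channel /dchannel.
have Ea : complex.Re alpha +i* complex.Im alpha = alpha by case: (alpha).
have hG (s : R) : cderivmx (fun h : R => b h *m (a h)^H) s
    (dsteering Nr g s *m (a s)^H + b s *m (dsteering Nt g s)^H).
  apply: cderivmxM; first exact: cderivmx_steering.
  exact/cderivmxH/cderivmx_steering.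
(* Along the angle, [alpha] is constant and the product rule applies to b a^H. Along the other two
   directions the angle is constant and the channel is affine in [h], with slope 1 or 'i times b
   a^H. *)
have [->|i0] := eqVneq i 0.
  under eq_fun do rewrite !mulr0 mulr1 !add0r Ea.
  have := cderivmxZ (cderiv_cst alpha 0) (fun i j => cderiv_shift (hG t i j)).
  by rewrite scale0r add0r.
have cm (u v : R) : cderiv (fun h => (h * u + complex.Re alpha) +i* (h * v + complex.Im alpha))
    0 (u +i* v).
  by split => /=; apply: is_derive_eq; rewrite /GRing.scale/=; ring.
under eq_fun do rewrite mulr0 add0r.
have := cderivmxZ (cm (i == 1)%:R (i == ord_max)%:R) (cderivmx_cst (b t *m (a t)^H) 0).
rewrite scaler0 addr0; case: i i0 {Ez} => [[|[|[|//]]] //= ?] _.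
by rewrite (_ : 1 +i* 0 = 1) ?scale1r.
Qed.

Lemma score_channel alpha t X Y i :
  score g sigma X (channel Nt Nr g alpha t *m X + Y) (zeta t alpha) i 0 =
  2 / sigma ^+ 2 * \sum_k rcoord (dchannel alpha t i *m X) k * rcoord Y k.
Proof.
rewrite mxE (derive_loglik _ _ (cderivmx_channel alpha t i)).
have -> : channel_at (zeta t alpha) = channel Nt Nr g alpha t.
  by rewrite /channel_at /zeta !mxE /=; case: alpha.
by rewrite addrC addKr.
Qed.

End Score.

(** * The Fisher information matrix *)

Section ConjugateTranspose.
Context {R : realType}.

Lemma hermM m n p (A : 'M[R[i]]_(m, n)) (B : 'M[R[i]]_(n, p)) :
  (A *m B)^H = B^H *m A^H.
Proof. by rewrite trmx_mul map_mxM. Qed.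

Lemma hermZ m n c (A : 'M[R[i]]_(m, n)) : (c *: A)^H = conjc c *: A^H.
Proof. by apply/matrixP => i j; rewrite !mxE rmorphM. Qed.

Lemma hermK m n (A : 'M[R[i]]_(m, n)) : (A^H)^H = A.
Proof. by apply/matrixP => i j; rewrite !mxE conjcK. Qed.

Lemma tr_herm n (A : 'M[R[i]]_n) : \tr (A^H) = conjc (\tr A).
Proof. by rewrite /mxtrace rmorph_sum; apply: eq_bigr => i _; rewrite !mxE. Qed.

Lemma tr_gram_mul m n p (A B : 'M[R[i]]_(m, n)) (X : 'M[R[i]]_(n, p)) :
  \tr ((A *m X)^H *m (B *m X)) = \tr (X *m X^H *m (A^H *m B)).
Proof. by rewrite hermM -[in RHS]mulmxA [in RHS]mxtrace_mulC !mulmxA. Qed.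

Lemma herm_col_sqnorm n (u : 'cV[R[i]]_n) : (u^H *m u) 0 0 = (sqnorm u)%:C.
Proof.
rewrite mxE /sqnorm rmorph_sum; apply: eq_bigr => i _.
rewrite big_ord_recl big_ord0 addr0 !mxE /sqmod.
by case: (u i 0) => c e; apply: complexP => /=; ring.
Qed.

End ConjugateTranspose.

(** * Gram matrices of the channel derivatives *)

Section ArrayGram.
Context (C : comNzRingType) (conj : {rmorphism C -> C}) (m n : nat).
Hypothesis conjK : involutive conj.
Local Notation "A ^h" := (map_mx conj (trmx A)) (at level 8).
Variables (W : 'M[C]_n).

Let hM p q r (A : 'M[C]_(p, q)) (B : 'M[C]_(q, r)) : (A *m B)^h = B^h *m A^h.
Proof. by rewrite trmx_mul map_mxM. Qed.

Let hD p q (A B : 'M[C]_(p, q)) : (A + B)^h = A^h + B^h.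
Proof. by rewrite raddfD map_mxD. Qed.

Let hZ p q c (A : 'M[C]_(p, q)) : (c *: A)^h = conj c *: A^h.
Proof. by apply/matrixP => i j; rewrite !mxE rmorphM. Qed.

Let hK p q (A : 'M[C]_(p, q)) : (A^h)^h = A.
Proof. by apply/matrixP => i j; rewrite !mxE conjK. Qed.

(** For rank-one factors the scalar p^H q comes out of the product. With [p], [q] among [b] and
    [db], orthogonality then removes all mixed terms. *)
Let gram (p q : 'cV[C]_m) (u v : 'cV[C]_n) :
  \tr ((p *m u^h)^h *m (q *m v^h) *m W) = (p^h *m q) 0 0 * \tr (u *m v^h *m W).
Proof.
rewrite hM hK -!mulmxA [p^h *m _]mulmxA [p^h *m q]mx11_scalar mul_scalar_mx.
by rewrite -scalemxAr mxtraceZ [X in _ = X * _]mxE eqxx mulr1n.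
Qed.

Lemma tr_form_expand (u v : 'cV[C]_n) c :
  \tr ((u + c *: v) *m (u + c *: v)^h *m W) =
  \tr (u *m u^h *m W) + conj c * \tr (u *m v^h *m W) +
  (c * \tr (v *m u^h *m W) + c * conj c * \tr (v *m v^h *m W)).
Proof.
rewrite hD hZ mulmxDl !mulmxDr !mulmxDl !mxtraceD.
by rewrite -!scalemxAr -!scalemxAl !mxtraceZ mulrA [conj c * c]mulrC.
Qed.

Variables (b db : 'cV[C]_m) (a da : 'cV[C]_n) (r alpha : C).
Hypothesis bb : (b^h *m b) 0 0 = r.
Hypothesis bdb : (b^h *m db) 0 0 = 0.
Hypothesis dbb : (db^h *m b) 0 0 = 0.
Let D := alpha *: (db *m a^h + b *m da^h).

Lemma tr_gram_dd : \tr (D^h *m D *m W) =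
  conj alpha * alpha * ((db^h *m db) 0 0 * \tr (a *m a^h *m W) +
                        r * \tr (da *m da^h *m W)).
Proof.
rewrite /D hZ hD -scalemxAl -scalemxAr -!scalemxAl !mxtraceZ mulrA.
rewrite mulmxDl !mulmxDr !mulmxDl !mxtraceD !gram bdb dbb bb.
by rewrite !mul0r addr0 add0r.
Qed.

Lemma tr_gram_dc c : \tr (D^h *m (c *: (b *m a^h)) *m W) =
  r * (c * (conj alpha * \tr (da *m a^h *m W))).
Proof.
rewrite /D hZ hD -scalemxAl -scalemxAr -!scalemxAl !mxtraceZ.
rewrite mulmxDl !mulmxDl !mxtraceD !gram dbb bb mul0r add0r.
by ring.
Qed.

Lemma tr_gram_cc c e : \tr ((c *: (b *m a^h))^h *m (e *: (b *m a^h)) *m W) =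
  r * (conj c * e * \tr (a *m a^h *m W)).
Proof.
by rewrite hZ -scalemxAl -scalemxAr -!scalemxAl !mxtraceZ gram bb; ring.
Qed.

End ArrayGram.

Section IntegralTrace.
Context {R : realType} {d : measure_display} {T : measurableType d}.
Context (mu : {measure set T -> \bar R}) (m n : nat) (f : T -> 'M[R[i]]_(m, n)).
Hypothesis fr : forall i j, mu.-integrable setT (fun x => (complex.Re (f x i j))%:E).
Hypothesis fi : forall i j, mu.-integrable setT (fun x => (complex.Im (f x i j))%:E).

Lemma Re_tr_integralmx (Q : 'M[R[i]]_(n, m)) :
  mu.-integrable setT (fun x => (complex.Re (\tr (f x *m Q)))%:E) /\
  \int[mu]_x complex.Re (\tr (f x *m Q)) = complex.Re (\tr (integralmx mu f *m Q)).
Proof.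
have E x : complex.Re (\tr (f x *m Q)) = \sum_i \sum_j
    (complex.Re (Q j i) * complex.Re (f x i j) + - complex.Im (Q j i) * complex.Im (f x i j)).
  rewrite /mxtrace Re_sum; apply: eq_bigr => i _.
  by rewrite mxE Re_sum; apply: eq_bigr => j _; rewrite ReM; ring.
have h i j : mu.-integrable setT (fun x =>
    (complex.Re (Q j i) * complex.Re (f x i j) + - complex.Im (Q j i) * complex.Im (f x i j))%:E).
  under eq_fun do rewrite EFinD.
  by apply: integrableD => //; exact: integrableZlR.
split; first by under eq_fun do rewrite E; do 2!(apply: integrable_sumR => ?).
under eq_Rintegral do rewrite E.
rewrite Rintegral_sum => [|i]; last exact: integrable_sumR.
rewrite /mxtrace Re_sum; apply: eq_bigr => i _.
rewrite Rintegral_sum => [|j]; last exact: h.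
rewrite mxE Re_sum; apply: eq_bigr => j _.
rewrite RintegralD//; [|exact: integrableZlR|exact: integrableZlR].
rewrite RintegralZl//; last exact: fr.
by rewrite RintegralZl//; [rewrite ReM !mxE/=; ring|exact: fi].
Qed.

Lemma Im_tr_integralmx (Q : 'M[R[i]]_(n, m)) :
  mu.-integrable setT (fun x => (complex.Im (\tr (f x *m Q)))%:E) /\
  \int[mu]_x complex.Im (\tr (f x *m Q)) = complex.Im (\tr (integralmx mu f *m Q)).
Proof.
(* Since Im z = Re(- i z), the imaginary part is the real case for a rotated [Q]. *)
have E (M : 'M[R[i]]_(m, n)) : complex.Im (\tr (M *m Q)) = complex.Re (\tr (M *m (- 'i *: Q))).
  rewrite -scalemxAr mxtraceZ; case: (\tr (M *m Q)) => a b /=; ring.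
have [h1 h2] := Re_tr_integralmx (- 'i *: Q).
by rewrite E -h2; split; [under eq_fun do rewrite E|under eq_Rintegral do rewrite E].
Qed.

Lemma integralmx_herm : integralmx mu (fun x => (f x)^H) = (integralmx mu f)^H.
Proof.
apply/matrixP => i j; rewrite !mxE; apply: complexP => /=.
  by apply: eq_Rintegral => x _; rewrite !mxE Re_conj.
under eq_Rintegral do rewrite !mxE Im_conj -mulN1r.
by rewrite RintegralZl ?mulN1r//; exact: fi.
Qed.

End IntegralTrace.

Section SteeringGram.
Context {R : realType} (N : nat) (g : geometry R) (t : R).
Local Notation b := (steering N g t).
Local Notation db := (dsteering N g t).

Lemma conj_expiM (x : R) : conjc (expi x) * expi x = 1.
Proof.
apply: complexP; rewrite /expi /=; last by ring.
by have := cos2Dsin2 x; rewrite !expr2 => <-; ring.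
Qed.

Lemma steering_norm : (b^H *m b) 0 0 = (N%:R : R)%:C.
Proof.
rewrite mxE (eq_bigr (fun=> 1)) ?sumr_const ?card_ord ?rmorph_nat// => i _.
by rewrite mxE mxE steeringE conj_expiM.
Qed.

(* This is where the centring of the array enters; it makes the steering vector orthogonal to its derivative. *)
Lemma sum_phase : \sum_(i < N) phase g i = 0.
Proof.
(* The centring constant [c] is freed from the number of terms so that induction on [n] goes
   through; the sum vanishes at c = n = N. *)
have S n (c : R) : \sum_(i < n) (c - 2 * i.+1%:R + 1) = n%:R * c - n%:R ^+ 2.
  elim: n => [|n ih]; first by rewrite big_ord0; ring.
  by rewrite big_ord_recr /= ih -natr1; ring.
rewrite (eq_bigr (fun i : 'I_N => (- (pi * spacing g * cosphi g / wavelength g)) *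
    (N%:R - 2 * i.+1%:R + 1))); last by move=> i _; rewrite /phase; ring.
by rewrite -mulr_sumr S; ring.
Qed.

Lemma steering_orthogonal : (b^H *m db) 0 0 = 0.
Proof.
rewrite mxE (eq_bigr (fun i => (0 +i* (phase g i * cos t)))).
  apply: complexP; first by rewrite Re_sum big1.
  by rewrite Im_sum /= -mulr_suml sum_phase mul0r.
by move=> i _; rewrite mxE mxE steeringE [dsteering _ _ _ _ _]mxE mulrCA conj_expiM mulr1.
Qed.

Lemma steering_orthogonal_sym : (db^H *m b) 0 0 = 0.
Proof.
have -> : (db^H *m b) 0 0 = conjc ((b^H *m db) 0 0).
  by rewrite -[b in LHS]hermK -hermM mxE mxE.
by rewrite steering_orthogonal; apply: complexP; rewrite //= oppr0.
Qed.

End SteeringGram.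

Section FimClosedForm.
Context {R : realType} {d : measure_display} {T : measurableType d}.
Context (P : probability T R) (Nt Nr L : nat) (L1 : (1 <= L)%N).
Variables (g : geometry R) (sigma : R) (sigma0 : 0 < sigma).
Variables (W : 'M[R[i]]_Nt) (X : T -> 'M[R[i]]_(Nt, L)) (N : T -> 'M[R[i]]_(Nr, L)).
Hypothesis HX : transmit_signal P W X.
Hypothesis HN : awgn P sigma X N.
Variable alpha : R[i].
Local Notation a := (steering Nt g).
Local Notation b := (steering Nr g).
Local Notation da := (dsteering Nt g).
Local Notation db := (dsteering Nr g).

Let outer l w := col l (X w) *m (col l (X w))^H.

Let outer_Re l i j :
  P.-integrable setT (fun w => (complex.Re (outer l w i j))%:E).
Proof.
under eq_fun.
  move=> w; rewrite mxE big_ord_recl big_ord0 addr0 !mxE ReM Re_conj Im_conj mulrN opprK.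
  rewrite -[complex.Re (X w i l)]/(rcoord (X w) (i, l, false)).
  rewrite -[complex.Re (X w j l)]/(rcoord (X w) (j, l, false)).
  rewrite -[complex.Im (X w i l)]/(rcoord (X w) (i, l, true)).
  rewrite -[complex.Im (X w j l)]/(rcoord (X w) (j, l, true)) EFinD.
  over.
by apply: integrableD => //; exact: (integrable_signalM HX).
Qed.

Let outer_Im l i j :
  P.-integrable setT (fun w => (complex.Im (outer l w i j))%:E).
Proof.
under eq_fun.
  move=> w; rewrite mxE big_ord_recl big_ord0 addr0 !mxE ImM Re_conj Im_conj mulrN.
  rewrite -[complex.Re (X w i l)]/(rcoord (X w) (i, l, false)).
  rewrite -[complex.Re (X w j l)]/(rcoord (X w) (j, l, false)).
  rewrite -[complex.Im (X w i l)]/(rcoord (X w) (i, l, true)).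
  rewrite -[complex.Im (X w j l)]/(rcoord (X w) (j, l, true)) addrC EFinB.
  over.
by apply: integrableB => //; exact: (integrable_signalM HX).
Qed.

Let l0 : 'I_L := Ordinal L1.

Lemma covariance_herm : W^H = W.
Proof.
case: HX => _ _ /(_ l0) <-.
rewrite -(integralmx_herm (outer_Im l0)); congr integralmx; apply/funext => w.
by rewrite hermM hermK.
Qed.

(** The form is v^H W v = E[|x^H v|^2] for a single column x of the signal. *)
Lemma covariance_psd (v : 'cV[R[i]]_Nt) : 0 <= complex.Re (\tr (v *m v^H *m W)).
Proof.
case: HX => _ _ /(_ l0) <-; rewrite mxtrace_mulC.
have [_ <-] := Re_tr_integralmx (outer_Re l0) (outer_Im l0) (v *m v^H).
apply: Rintegral_ge0 => w _; rewrite /outer.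
set x := col l0 (X w).
have -> : \tr (x *m x^H *m (v *m v^H)) = ((x^H *m v)^H *m (x^H *m v)) 0 0.
  by rewrite -trace_mx11 hermM hermK mulmxA mxtrace_mulC !mulmxA.
rewrite herm_col_sqnorm /=; do 2!(apply: sumr_ge0 => ? _).
exact: sqmod_ge0.
Qed.

Lemma tr_form_conj (u v : 'cV[R[i]]_Nt) :
  \tr (v *m u^H *m W) = conjc (\tr (u *m v^H *m W)).
Proof.
by rewrite -tr_herm hermM covariance_herm hermM hermK mxtrace_mulC.
Qed.

Lemma Im_tr_form (u : 'cV[R[i]]_Nt) : complex.Im (\tr (u *m u^H *m W)) = 0.
Proof.
have := congr1 (@complex.Im R) (tr_form_conj u u); rewrite Im_conj.
by move=> /eqP; rewrite -addr_eq0 -mulr2n mulrn_eq0 /= => /eqP.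
Qed.

Lemma fim_trace t i j : fim P g sigma X N alpha t i j =
  2 * L%:R / sigma ^+ 2 *
  complex.Re (\tr ((dchannel Nt Nr g alpha t i)^H *m dchannel Nt Nr g alpha t j *m W)).
Proof.
rewrite mxE.
set Mi := dchannel _ _ _ _ _ i; set Mj := dchannel _ _ _ _ _ j.
have [ci hi] := rcoord_mulmx L Mi; have [cj hj] := rcoord_mulmx L Mj.
rewrite (@eq_Rintegral _ _ _ _ _ (fun w => (2 / sigma ^+ 2) ^+ 2 *
   ((\sum_k (\sum_j ci k j * rcoord (X w) j) * rcoord (N w) k) *
    (\sum_k (\sum_j cj k j * rcoord (X w) j) * rcoord (N w) k)))); last first.
  move=> w _; rewrite mxE big_ord_recl big_ord0 addr0 [X in _ * X]mxE !score_channel//.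
  under eq_bigr do rewrite hi.
  under [X in _ * (_ * X)]eq_bigr do rewrite hj.
  by ring.
(* The noise variance sigma^2 / 2 turns the squared factor (2 / sigma^2)^2 into 2 / sigma^2. The
   factor L comes from the columns of X below, each with covariance [W]. *)
have [iB eB] := bilinear_signal_noise_moment sigma0 HX HN ci cj.
rewrite RintegralZl// eB.
set Q := Mi^H *m Mj.
have XXH w : X w *m (X w)^H = \sum_l outer l w.
  apply/matrixP => u v; rewrite summxE mxE; apply: eq_bigr => l _.
  by rewrite /outer [in RHS]mxE big_ord_recl big_ord0 addr0 !mxE.
under eq_Rintegral.
  move=> w _; under eq_bigr do rewrite -hi -hj.
  rewrite sum_rcoordM tr_gram_mul -/Q XXH mulmx_suml.
  rewrite (_ : \tr (\sum_l _) = \sum_l \tr (outer l w *m Q)); last exact: raddf_sum.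
  rewrite Re_sum.
  over.
rewrite Rintegral_sum; last first.
  by move=> l; have [] := Re_tr_integralmx (outer_Re l) (outer_Im l) Q.
rewrite (eq_bigr (fun=> complex.Re (\tr (W *m Q)))); last first.
  move=> l _; have [_ ->] := Re_tr_integralmx (outer_Re l) (outer_Im l) Q.
  by case: HX => _ _ /(_ l) ->.
rewrite sumr_const card_ord mxtrace_mulC -mulr_natr.
by field; rewrite gt_eqF.
Qed.

Lemma fimC t i j : fim P g sigma X N alpha t i j = fim P g sigma X N alpha t j i.
Proof.
rewrite !mxE; apply: eq_Rintegral => w _; rewrite !mxE; apply: eq_bigr => k _.
by rewrite [X in _ * X]mxE [in RHS]mulrC [in RHS]mxE.
Qed.

Definition arrow_mx (J u v s : R) : 'M[R]_3 :=
  \matrix_(i, j) (nth [::] [:: [:: J; u; v]; [:: u; s; 0]; [:: v; 0; s]] i)`_j.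

Lemma fim_arrow t : let tau := conjc alpha * \tr (da t *m (a t)^H *m W) in
  let k := 2 * L%:R / sigma ^+ 2 in
  fim P g sigma X N alpha t = arrow_mx
    (k * (sqmod alpha * (sqnorm (db t) * complex.Re (\tr (a t *m (a t)^H *m W)) +
                         Nr%:R * complex.Re (\tr (da t *m (da t)^H *m W)))))
    (k * (Nr%:R * complex.Re tau)) (k * (- (Nr%:R * complex.Im tau)))
    (k * (Nr%:R * complex.Re (\tr (a t *m (a t)^H *m W)))).
Proof.
move=> tau k.
have bb := steering_norm Nr g t.
have bdb := steering_orthogonal Nr g t.
have dbb := steering_orthogonal_sym Nr g t.
have cK : involutive (@conjc R) := @conjcK R.
have D1 : dchannel Nt Nr g alpha t 1 = 1 *: (b t *m (a t)^H) by rewrite scale1r.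
have D2 : dchannel Nt Nr g alpha t ord_max = 'i *: (b t *m (a t)^H) by [].
have e00 : fim P g sigma X N alpha t 0 0 =
    k * (sqmod alpha * (sqnorm (db t) * complex.Re (\tr (a t *m (a t)^H *m W)) +
                         Nr%:R * complex.Re (\tr (da t *m (da t)^H *m W)))).
  rewrite fim_trace (tr_gram_dd cK W (a t) (da t) alpha bb bdb dbb).
  rewrite conj_mulE herm_col_sqnorm Re_realM; congr (_ * (_ * _)).
  by rewrite ReD; congr (_ + _); exact: Re_realM.
have dc := tr_gram_dc cK W (a t) (da t) alpha bb dbb.
have cc := tr_gram_cc cK W (a t) bb.
have e01 : fim P g sigma X N alpha t 0 1 = k * (Nr%:R * complex.Re tau).
  by rewrite fim_trace D1 dc mul1r Re_realM.
have e02 : fim P g sigma X N alpha t 0 ord_max = k * (- (Nr%:R * complex.Im tau)).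
  by rewrite fim_trace D2 dc Re_realM Re_iM mulrN.
have e11 : fim P g sigma X N alpha t 1 1 =
    k * (Nr%:R * complex.Re (\tr (a t *m (a t)^H *m W))).
  by rewrite fim_trace D1 cc rmorph1 !mul1r Re_realM.
(* The two directions of [alpha] differ by the factor 'i, and the trace of a a^H W is real, so the
   real part of their product is 0. *)
have e12 : fim P g sigma X N alpha t 1 ord_max = 0.
  rewrite fim_trace D1 D2 cc rmorph1 mul1r Re_realM Re_iM Im_tr_form.
  by rewrite oppr0 !mulr0.
have e22 : fim P g sigma X N alpha t ord_max ord_max =
    k * (Nr%:R * complex.Re (\tr (a t *m (a t)^H *m W))).
  rewrite fim_trace D2 cc conj_mulE (_ : sqmod 'i = 1) ?mul1r ?Re_realM//.
  by rewrite /sqmod/= expr0n expr1n add0r.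
apply/matrixP => i j; rewrite [RHS]mxE.
have o1 (lt1 : (1 < 3)%N) : Ordinal lt1 = 1 :> 'I_3 by apply/val_inj.
have o0 (lt0 : (0 < 3)%N) : Ordinal lt0 = 0 :> 'I_3 by apply/val_inj.
have o2 (lt2 : (2 < 3)%N) : Ordinal lt2 = ord_max :> 'I_3 by apply/val_inj.
case: i => [[|[|[|//]]] hi]; case: j => [[|[|[|//]]] hj] /=;
  rewrite ?o0 ?o1 ?o2 //; by rewrite fimC.
Qed.

End FimClosedForm.

(** * Inversion of arrow matrices *)

Section ArrowMatrix.
Context {R : realType}.
Implicit Types J u v s : R.

Lemma det_arrow J u v s : \det (arrow_mx J u v s) = s * (s * J - u ^+ 2 - v ^+ 2).
Proof.
rewrite (expand_det_row _ 0) !big_ord_recl big_ord0 /cofactor.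
rewrite !(expand_det_row _ 0) !big_ord_recl !big_ord0 /cofactor.
rewrite !det_mx11 !mxE /=.
by rewrite /bump /=; ring.
Qed.

Lemma arrow_unit J u v s : (arrow_mx J u v s \in unitmx) =
  (s != 0) && (J - (u ^+ 2 + v ^+ 2) / s != 0).
Proof.
rewrite unitmxE unitfE det_arrow mulf_eq0 negb_or.
have [->//|s0] := eqVneq s 0; rewrite /=.
have -> : s * J - u ^+ 2 - v ^+ 2 = s * (J - (u ^+ 2 + v ^+ 2) / s) by field.
by rewrite mulf_eq0 (negbTE s0).
Qed.

(** The first row (x, y, z) of the inverse satisfies three scalar equations. Two of them express [y]
    and [z] through [x], and the third becomes x times the Schur complement equal to 1. *)
Lemma invmx_arrow J u v s : arrow_mx J u v s \in unitmx ->
  invmx (arrow_mx J u v s) 0 0 = (J - (u ^+ 2 + v ^+ 2) / s)^-1.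
Proof.
move=> Au; have := Au; rewrite arrow_unit => /andP[s0 D0].
have := mulVmx Au; set B := invmx _ => BA.
have E j := congr1 (fun M : 'M[R]_3 => M 0 j) BA.
move: (E 0) (E 1) (E ord_max); rewrite !mxE !big_ord_recl !big_ord0 !mxE /=.
rewrite !mulr0 !addr0 !add0r => e0 e1 e2.
set x := B 0 0 in e0 e1 e2 *; set y := B 0 _ in e0 e1; set z := B 0 _ in e0 e2.
have ey : y = - (x * u / s).
  by apply: (mulIf s0); rewrite mulNr divfK//; apply/eqP; rewrite -addr_eq0 addrC e1.
have ez : z = - (x * v / s).
  by apply: (mulIf s0); rewrite mulNr divfK//; apply/eqP; rewrite -addr_eq0 addrC e2.
apply: (mulIf D0); rewrite mulVf//.
transitivity (x * J + (y * u + z * v)); last exact: e0.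
by rewrite ey ez; field.
Qed.

End ArrowMatrix.

(** * Averages over the prior *)

Section BoundedMeasurable.
Context {R : realType}.

(** A class closed under sums and products whose members are integrable against the prior; all
    entries of the Fisher matrix lie in it, so they can be averaged term by term. *)
Definition bounded_mfun (f : R -> R) :=
  measurable_fun setT f /\ exists M, forall x, `|f x| <= M.

Lemma bounded_mfun_cst c : bounded_mfun (fun=> c).
Proof. by split; [exact: measurable_cst|exists `|c|]. Qed.

Lemma bounded_mfunD f h : bounded_mfun f -> bounded_mfun h ->
  bounded_mfun (fun x => f x + h x).
Proof.
move=> [mf [M fM]] [mh [M' hM']]; split; first exact: measurable_funD.
by exists (M + M') => x; rewrite (le_trans (ler_normD _ _))// lerD.
Qed.

Lemma bounded_mfunM f h : bounded_mfun f -> bounded_mfun h ->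
  bounded_mfun (fun x => f x * h x).
Proof.
move=> [mf [M fM]] [mh [M' hM']]; split; first exact: measurable_funM.
by exists (M * M') => x; rewrite normrM ler_pM.
Qed.

Lemma bounded_mfunN f : bounded_mfun f -> bounded_mfun (fun x => - f x).
Proof.
move=> [mf [M fM]]; split; first exact: measurableT_comp.
by exists M => x; rewrite normrN.
Qed.

Lemma bounded_mfun_sum (I : Type) (r : seq I) (f : I -> R -> R) :
  (forall i, bounded_mfun (f i)) -> bounded_mfun (fun x => \sum_(i <- r) f i x).
Proof.
move=> h; elim: r => [|i r ih].
  by under eq_fun do rewrite big_nil; exact: bounded_mfun_cst.
by under eq_fun do rewrite big_cons; exact: bounded_mfunD.
Qed.

Lemma bounded_mfun_cos : bounded_mfun cos.
Proof.
split; first by apply: continuous_measurable_fun; exact: continuous_cos.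
by exists 1 => x; rewrite ler_norml cos_geN1 cos_le1.
Qed.

Lemma bounded_mfun_cos_phase c : bounded_mfun (fun t => cos (c * sin t)).
Proof.
split.
  apply: continuous_measurable_fun => x; apply: continuous_comp => //=.
    by apply: cvgM; [exact: cvg_cst|exact: continuous_sin].
  exact: continuous_cos.
by exists 1 => x; rewrite ler_norml cos_geN1 cos_le1.
Qed.

Lemma bounded_mfun_sin_phase c : bounded_mfun (fun t => sin (c * sin t)).
Proof.
split.
  apply: continuous_measurable_fun => x; apply: continuous_comp => //=.
    by apply: cvgM; [exact: cvg_cst|exact: continuous_sin].
  exact: continuous_sin.
by exists 1 => x; rewrite ler_norml sin_geN1 sin_le1.
Qed.

Definition bounded_cfun (f : R -> R[i]) :=
  bounded_mfun (fun x => complex.Re (f x)) /\ bounded_mfun (fun x => complex.Im (f x)).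

Lemma bounded_cfunM f h : bounded_cfun f -> bounded_cfun h ->
  bounded_cfun (fun x => f x * h x).
Proof.
move=> [fr fi] [hr hi]; split.
  under eq_fun do rewrite ReM.
  by apply: bounded_mfunD; [|apply: bounded_mfunN]; exact: bounded_mfunM.
under eq_fun do rewrite ImM.
by apply: bounded_mfunD; exact: bounded_mfunM.
Qed.

Lemma bounded_cfun_sum (I : Type) (r : seq I) (f : I -> R -> R[i]) :
  (forall i, bounded_cfun (f i)) -> bounded_cfun (fun x => \sum_(i <- r) f i x).
Proof.
move=> h; split.
  by under eq_fun do rewrite Re_sum; apply: bounded_mfun_sum => i; have [] := h i.
by under eq_fun do rewrite Im_sum; apply: bounded_mfun_sum => i; have [] := h i.
Qed.

Definition bounded_mxfun m n (F : R -> 'M[R[i]]_(m, n)) :=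
  forall i j, bounded_cfun (fun x => F x i j).

Lemma bounded_mxfunM m n p (F : R -> 'M[R[i]]_(m, n)) (G : R -> 'M[R[i]]_(n, p)) :
  bounded_mxfun F -> bounded_mxfun G -> bounded_mxfun (fun x => F x *m G x).
Proof.
move=> hF hG i j; under eq_fun do rewrite mxE.
by apply: bounded_cfun_sum => k; exact: bounded_cfunM.
Qed.

Lemma bounded_mxfunH m n (F : R -> 'M[R[i]]_(m, n)) :
  bounded_mxfun F -> bounded_mxfun (fun x => (F x)^H).
Proof.
move=> hF i j; under eq_fun do rewrite !mxE; have [fr fi] := hF j i; split.
  by under eq_fun do rewrite Re_conj.
by under eq_fun do rewrite Im_conj; exact: bounded_mfunN.
Qed.

Lemma bounded_mxfunZ m n (f : R -> R) (F : R -> 'M[R[i]]_(m, n)) :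
  bounded_mfun f -> bounded_mxfun F -> bounded_mxfun (fun x => (f x)%:C *: F x).
Proof.
move=> hf hF i j; under eq_fun do rewrite mxE; have [fr fi] := hF i j; split.
  by under eq_fun do rewrite Re_realM; exact: bounded_mfunM.
by under eq_fun do rewrite Im_realM; exact: bounded_mfunM.
Qed.

Lemma bounded_mfun_sqnorm m n (F : R -> 'M[R[i]]_(m, n)) :
  bounded_mxfun F -> bounded_mfun (fun x => sqnorm (F x)).
Proof.
move=> hF; apply: bounded_mfun_sum => i; apply: bounded_mfun_sum => j; have [fr fi] := hF i j.
rewrite /sqmod; under eq_fun do rewrite !expr2.
by apply: bounded_mfunD; exact: bounded_mfunM.
Qed.

Lemma bounded_steering N (g : geometry R) : bounded_mxfun (steering N g).
Proof.
move=> i j; rewrite ord1; under eq_fun do rewrite steeringE.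
by split; [exact: bounded_mfun_cos_phase|exact: bounded_mfun_sin_phase].
Qed.

Lemma bounded_dsteering N (g : geometry R) : bounded_mxfun (dsteering N g).
Proof.
move=> i j; under eq_fun do rewrite mxE; apply: bounded_cfunM; split.
- exact: bounded_mfun_cst.
- by apply: bounded_mfunM; [exact: bounded_mfun_cst|exact: bounded_mfun_cos].
- exact: bounded_mfun_cos_phase.
- exact: bounded_mfun_sin_phase.
Qed.

Lemma bounded_tr m n (F : R -> 'M[R[i]]_(m, n)) (Q : 'M[R[i]]_(n, m)) :
  bounded_mxfun F -> bounded_cfun (fun x => \tr (F x *m Q)).
Proof.
move=> hF; apply: bounded_cfun_sum => i; apply: bounded_mxfunM => // j k.
by split; exact: bounded_mfun_cst.
Qed.

End BoundedMeasurable.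

Section Prior.
Context {R : realType} (K : nat) (q : mixture R K).
Local Notation mu := (@lebesgue_measure R).
Hypothesis weight_ge0 : forall k, 0 <= weight q k.
Hypothesis weight_sum : \sum_k weight q k = 1.
Hypothesis stddev0 : forall k, 0 < stddev q k.

Lemma prior_ge0 t : 0 <= prior q t.
Proof. by apply: sumr_ge0 => k _; rewrite mulr_ge0// normal_pdf_ge0. Qed.

Lemma prior_gt0 t : 0 < prior q t.
Proof.
have [k k0] : exists k, 0 < weight q k.
  apply: contrapT => /forallNP h; have := @oner_neq0 R.
  rewrite -weight_sum big1 ?eqxx// => k _; apply: le_anti.
  by rewrite weight_ge0 andbT leNgt; apply/negP/h.
rewrite /prior (bigD1 k)//= ltr_wpDr//.
  by apply: sumr_ge0 => l _; rewrite mulr_ge0// normal_pdf_ge0.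
rewrite mulr_gt0// normal_pdfE ?gt_eqF// mulr_gt0 ?expR_gt0//.
by rewrite normal_peak_gt0 ?gt_eqF.
Qed.

Lemma continuous_prior : continuous (prior q).
Proof.
move=> x; rewrite /prior; apply: cvg_big => [|k _]; first exact: add_continuous.
by apply: cvgM; [exact: cvg_cst|apply: continuous_normal_pdf; rewrite gt_eqF].
Qed.

Lemma integrable_prior : mu.-integrable setT (fun t => (prior q t)%:E).
Proof.
by apply: integrable_sumR => k; apply: integrableZlR; exact: integrable_normal_pdf.
Qed.

Lemma integrable_bounded_prior h : bounded_mfun h ->
  mu.-integrable setT (fun t => (h t * prior q t)%:E).
Proof.
move=> [mh [M hM]].
apply: (le_integrable measurableT _ _ (integrableZlR M integrable_prior)).
  apply/measurable_EFinP; apply: measurable_funM => //.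
  by apply: continuous_measurable_fun; exact: continuous_prior.
move=> t _ /=; rewrite lee_fin !normrM ler_wpM2r//.
by rewrite (le_trans (hM t))// ler_norm.
Qed.

Definition expect (h : R -> R) : R := \int[mu]_t (h t * prior q t).

Lemma expectD f h : bounded_mfun f -> bounded_mfun h ->
  expect (fun t => f t + h t) = expect f + expect h.
Proof.
move=> bf bh; rewrite /expect -RintegralD//; [|exact: integrable_bounded_prior..].
by apply: eq_Rintegral => t _; rewrite mulrDl.
Qed.

Lemma expectZ c h : bounded_mfun h -> expect (fun t => c * h t) = c * expect h.
Proof.
move=> bh; rewrite /expect -RintegralZl//; last exact: integrable_bounded_prior.
by apply: eq_Rintegral => t _; rewrite mulrA.
Qed.

Lemma expect_ge0 h : (forall t, 0 <= h t) -> 0 <= expect h.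
Proof. by move=> h0; apply: Rintegral_ge0 => t _; rewrite mulr_ge0// prior_ge0. Qed.

Lemma expect0 : expect (fun=> 0) = 0.
Proof.
by rewrite /expect; under eq_Rintegral do rewrite mul0r; rewrite Rintegral_cst// mul0r.
Qed.

Lemma expect_tr n (F : R -> 'M[R[i]]_n) (W : 'M[R[i]]_n) : bounded_mxfun F ->
  let A := integralmx mu (fun t => (prior q t)%:C *: F t) in
  expect (fun t => complex.Re (\tr (F t *m W))) = complex.Re (\tr (A *m W)) /\
  expect (fun t => complex.Im (\tr (F t *m W))) = complex.Im (\tr (A *m W)).
Proof.
move=> bF A.
have hr i j : mu.-integrable setT (fun t => (complex.Re (((prior q t)%:C *: F t) i j))%:E).
  under eq_fun do rewrite mxE Re_realM mulrC.
  by apply: integrable_bounded_prior; have [] := bF i j.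
have hi i j : mu.-integrable setT (fun t => (complex.Im (((prior q t)%:C *: F t) i j))%:E).
  under eq_fun do rewrite mxE Im_realM mulrC.
  by apply: integrable_bounded_prior; have [] := bF i j.
have [_ er] := Re_tr_integralmx hr hi W; have [_ ei] := Im_tr_integralmx hr hi W.
rewrite -er -ei; split; apply: eq_Rintegral => t _.
  by rewrite -scalemxAl mxtraceZ Re_realM mulrC.
by rewrite -scalemxAl mxtraceZ Im_realM mulrC.
Qed.

End Prior.

(** * Nonnegativity of the prior information *)

Section PriorInformation.
Context {R : realType} (K : nat) (q : mixture R K).
Local Notation mu := (@lebesgue_measure R).
Hypothesis weight_ge0 : forall k, 0 <= weight q k.
Hypothesis weight_sum : \sum_k weight q k = 1.
Hypothesis stddev0 : forall k, 0 < stddev q k.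

Let f k t := normal_pdf (mean q k) (stddev q k) t.
Let u k t := (t - mean q k) / stddev q k ^+ 2.
Let wf k t := weight q k * f k t.

Let cwf k : continuous (wf k).
Proof.
by move=> t; apply: cvgM; [exact: cvg_cst|apply: continuous_normal_pdf; rewrite gt_eqF].
Qed.

Let cu k : continuous (u k).
Proof.
move=> t; apply: cvgM; last exact: cvg_cst.
by apply: cvgB; [exact: cvg_id|exact: cvg_cst].
Qed.

Let S t := \sum_k wf k t * u k t ^+ 2.

Let term_moment k :
  mu.-integrable setT (fun t => (wf k t * u k t ^+ 2)%:E) /\
  \int[mu]_t (wf k t * u k t ^+ 2) = weight q k / stddev q k ^+ 2.
Proof.
have s0 := stddev0 k; have H := integral_normal_pdf_moment2 (mean q k) s0.
have i2 : mu.-integrable setT (fun t => ((t - mean q k) ^+ 2 * f k t)%:E).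
  apply/integrableP; split.
    apply/measurable_EFinP; apply: measurable_funM; last exact: measurable_normal_pdf.
    by apply: measurable_funX; exact: measurable_funB.
  have g0 t : 0 <= (t - mean q k) ^+ 2 * f k t.
    by rewrite mulr_ge0 ?sqr_ge0 ?normal_pdf_ge0.
  under eq_integral do rewrite /= ger0_norm ?g0//.
  by rewrite H ltry.
have E t : wf k t * u k t ^+ 2 =
    (weight q k / stddev q k ^+ 4) * ((t - mean q k) ^+ 2 * f k t).
  by rewrite /wf /u; field; rewrite gt_eqF.
split; first by under eq_fun do rewrite E; exact: integrableZlR.
under eq_Rintegral do rewrite E.
rewrite RintegralZl// [X in _ * X = _]/Rintegral H /=.
by field; rewrite gt_eqF.
Qed.

(** Lagrange's identity: with weights w_k, the double sum of w_k w_l (u_k - u_l)^2 is 2 (sum w)(sum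
    w u^2) - 2 (sum w u)^2. Here sum w is the prior p and sum w u is -p', so the subtracted term is
    p'^2 / p. *)
Let rho_integrand t : (\sum_k1 \sum_k2 weight q k1 * weight q k2 * f k1 t * f k2 t *
     (u k1 t - u k2 t) ^+ 2) / (2 * \sum_k weight q k * f k t) =
  S t - (\sum_k wf k t * u k t) ^+ 2 / prior q t.
Proof.
have p0 := prior_gt0 weight_ge0 weight_sum stddev0 t.
have -> : \sum_k weight q k * f k t = prior q t by [].
have -> : \sum_k1 \sum_k2 weight q k1 * weight q k2 * f k1 t * f k2 t *
     (u k1 t - u k2 t) ^+ 2 =
   2 * (prior q t * S t) - 2 * (\sum_k wf k t * u k t) ^+ 2.
  pose v k := wf k t * u k t; pose m := \sum_k v k.
  transitivity (\sum_k1 (wf k1 t * u k1 t ^+ 2 * prior q t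
      - 2 * (v k1 * m) + wf k1 t * S t)).
    apply: eq_bigr => k1 _.
    rewrite /prior /m /S !mulr_sumr -sumrN -!big_split/=; apply: eq_bigr => k2 _.
    by rewrite /v /wf /f; ring.
  rewrite !big_split/= sumrN -mulr_sumr -!mulr_suml -/S -/m.
  by rewrite -[\sum_k wf k t]/(prior q t) -[\sum_k wf k t * u k t ^+ 2]/(S t); ring.
by field; rewrite gt_eqF.
Qed.

(** The integrand of [rho] lies between 0 and [S]. This makes it integrable, and [S] integrates to
    the sum of the weight q k / stddev q k ^+ 2. *)
Lemma prior_info_ge0 : 0 <= prior_info q.
Proof.
have iS : mu.-integrable setT (fun t => (S t)%:E).
  by apply: integrable_sumR => k; have [] := term_moment k.
have IS : \int[mu]_t S t = \sum_k weight q k / stddev q k ^+ 2.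
  rewrite Rintegral_sum => [|k]; last by have [] := term_moment k.
  by apply: eq_bigr => k _; have [_ ->] := term_moment k.
rewrite /prior_info -IS subr_ge0 /rho.
have p0 t := prior_gt0 weight_ge0 weight_sum stddev0 t.
have r0 t : 0 <= (\sum_k wf k t * u k t) ^+ 2 / prior q t.
  by rewrite divr_ge0 ?sqr_ge0// ltW.
under eq_Rintegral do rewrite rho_integrand.
have I0 t : 0 <= S t - (\sum_k wf k t * u k t) ^+ 2 / prior q t.
  rewrite -rho_integrand; apply: divr_ge0; last first.
    by apply: mulr_ge0 => //; exact: ltW (p0 t).
  have f0 k : 0 <= f k t by exact: normal_pdf_ge0.
  apply: sumr_ge0 => k1 _; apply: sumr_ge0 => k2 _.
  by rewrite mulr_ge0 ?sqr_ge0// !mulr_ge0.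
have le t : S t - (\sum_k wf k t * u k t) ^+ 2 / prior q t <= S t.
  by rewrite gerBl.
apply: le_Rintegral => //.
apply: (le_integrable measurableT _ _ iS); last first.
  by move=> t _ /=; rewrite lee_fin !ger0_norm// (le_trans (I0 t)).
apply/measurable_EFinP; apply: continuous_measurable_fun => t.
have cs (h : 'I_K -> R -> R) : (forall k, continuous (h k)) ->
    continuous (fun t => \sum_k h k t).
  by move=> ch x; apply: cvg_big => [|k _]; [exact: add_continuous|exact: ch].
have cwu k : continuous (fun t => wf k t * u k t).
  by move=> x; apply: cvgM; [exact: cwf|exact: cu].
apply: cvgB.
  apply: (cs (fun k t => wf k t * u k t ^+ 2)) => k x.
  apply: cvgM; first exact: cwf.
  by apply: (cvg_comp (u k) (fun y => y ^+ 2)); [exact: cu|exact: exprn_continuous].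
apply: cvgM.
  apply: (cvg_comp (fun t => \sum_k wf k t * u k t) (fun y => y ^+ 2)).
    exact: (cs (fun k t => wf k t * u k t)).
  exact: exprn_continuous.
by apply: cvgV; [rewrite gt_eqF|exact: continuous_prior].
Qed.

End PriorInformation.

(** * Divergence of the averaged bound *)

Section Pole.
Context {R : realType}.
Local Notation mu := (@lebesgue_measure R).

(** The integral of a nonnegative function is a supremum over the simple functions below it, and [h]
    has at least those below [f]. This covers arbitrary functions, such as the bounds built from
    [inv11]. *)
Lemma ge0_le_lower_integral d (T : measurableType d) (m : {measure set T -> \bar R})
    (f h : T -> \bar R) :
  (forall x, (0 <= f x)%E) -> (forall x, (f x <= h x)%E) ->
  (\int[m]_x f x <= \int[m]_x h x)%E.
Proof.
move=> f0 fh; rewrite !ge0_integralTE => [||x//]; last first.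
  by move=> x; rewrite (le_trans (f0 x)).
apply: ereal_sup_le => _ [s /= sf <-]; exists s => // x.
exact: le_trans (fh x).
Qed.

Lemma normr_sin_le (x : R) : 0 <= x -> `|sin x| <= x.
Proof.
move=> x0; have [|c _] := @MVT_segment R sin cos 0 x x0.
  by apply: continuous_subspaceT; exact: continuous_sin.
rewrite sin0 !subr0 => ->; rewrite normrM (ger0_norm x0) ler_piMl//.
by rewrite ler_norml cos_geN1 cos_le1.
Qed.

Lemma normr_cos_near_pihalf (t e : R) : pi / 2 <= t <= pi / 2 + e -> `|cos t| <= e.
Proof.
move=> /andP[h1 h2]; rewrite -(subrK (pi / 2) t) cosDpihalf normrN.
rewrite (le_trans (normr_sin_le _)) ?subr_ge0//.
by rewrite lerBlDl.
Qed.

Variables (K : nat) (q : mixture R K).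
Hypothesis weight_ge0 : forall k, 0 <= weight q k.
Hypothesis weight_sum : \sum_k weight q k = 1.
Hypothesis stddev0 : forall k, 0 < stddev q k.

(* [cos t] has a simple zero at [pi / 2], where the prior density is positive:
   a pole of order two there is not integrable. *)
Lemma prior_mean_pole (h : R -> \bar R) (B : R) : 0 < B ->
  (forall t, (0 <= h t)%E) ->
  (forall t e, 0 < e -> `|cos t| <= e -> ((B * e ^+ 2)^-1%:E <= h t)%E) ->
  prior_mean q h = +oo%E.
Proof.
move=> B0 h0 hB; apply/eqyP => A A0.
have q0 := prior_gt0 weight_ge0 weight_sum stddev0.
pose c := prior q (pi / 2) / 2.
have c0 : 0 < c by rewrite divr_gt0.
have /cvgrPdist_le/(_ c c0) := @continuous_prior R K q stddev0 (pi / 2).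
rewrite near_nbhs => /nbhs_ballP[r /= r0 near_r].
have hr t : ball (pi / 2) r t -> c <= prior q t.
  by move/near_r => /=; rewrite ler_norml => /andP[_]; rewrite /c => hp; lra.
(* The first term keeps the interval inside the ball where the prior is at least [c]. The second
   makes the lower bound (c / (B e^2)) e = c / (B e) at least [A]. *)
pose e := Num.min (r / 2) (c / (B * A)).
have e0 : 0 < e by rewrite lt_min !divr_gt0// mulr_gt0.
have er : e < r by rewrite gt_min ltr_pdivrMr// ltr_pMr// ltr1n.
pose I : set R := `[pi / 2, pi / 2 + e]%classic.
pose k := (B * e ^+ 2)^-1 * c.
have k0 : 0 <= k by rewrite mulr_ge0 ?ltW// invr_gt0 mulr_gt0 ?exprn_gt0.
have low : (\int[mu]_t (k * \1_I t)%:E <= prior_mean q h)%E.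
  apply: ge0_le_lower_integral => t; first by rewrite lee_fin mulr_ge0.
  rewrite indicE; case: (boolP (t \in I)) => tI; last first.
    by rewrite mulr0 mule_ge0// lee_fin ltW.
  move: tI; rewrite inE /I/= in_itv/= => tI.
  rewrite mulr1 EFinM lee_pmul//.
  - by rewrite lee_fin invr_ge0 mulr_ge0 ?ltW ?exprn_gt0.
  - by rewrite lee_fin ltW.
  - by apply: hB => //; exact: normr_cos_near_pihalf.
  - rewrite lee_fin; apply: hr; rewrite /ball/= distrC ger0_norm ?subr_ge0; last by case/andP: tI.
    by case/andP: tI => _ tle; rewrite (le_lt_trans _ er)// lerBlDl.
apply: le_trans low; under eq_integral do rewrite EFinM.
rewrite ge0_integralZl//=; last first.
  by apply/measurable_EFinP; apply: measurable_indic; exact: measurable_itv.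
have mI : measurable (I : set (measurableTypeR R)) by exact: measurable_itv.
have muI : mu I = e%:E.
  by rewrite lebesgue_measure_itv /= lte_fin ltrDl e0 -EFinD addrAC subrr add0r.
have -> : (\int[mu]_x (\1_I x)%:E = e%:E)%E.
  by rewrite (integral_indic mu measurableT mI) setIT; exact: muI.
rewrite -EFinM lee_fin.
have -> : k * e = c / (B * e) by rewrite /k; field; rewrite !gt_eqF.
have : e <= c / (B * A) by rewrite ge_min lexx orbT.
rewrite !ler_pdivlMr ?mulr_gt0//; apply: le_trans.
by have -> : A * (B * e) = e * (B * A) by ring.
Qed.

End Pole.

(** * Cauchy-Schwarz for the steering forms and their order at pi / 2 *)

Section Bounds.
Context {R : realType}.

Lemma one_div_fin (x : R) : x != 0 -> (1 / x%:E = (x^-1)%:E)%E.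
Proof. by move=> x0; rewrite mul1e inver (negbTE x0). Qed.

Lemma le_inve_fin (x y : R) : 0 <= x -> x <= y -> 0 < y ->
  ((y^-1)%:E <= x%:E^-1)%E.
Proof.
move=> x0 xy y0; rewrite inver; case: eqVneq => [_|xn0]; first exact: leey.
by rewrite lee_fin lef_pV2// posrE lt_neqAle eq_sym xn0.
Qed.

Lemma schwarz_from_form (A B : R) (tau : R[i]) : 0 < B ->
  (forall z : R[i], 0 <= A - 2 * complex.Re (conjc z * tau) + sqmod z * B) ->
  sqmod tau / B <= A.
Proof.
(* The minimizer z = tau / B of the quadratic form. *)
move=> B0 /(_ ((complex.Re tau / B) +i* (complex.Im tau / B))).
rewrite ReM /sqmod /= => h; rewrite -subr_ge0; apply: le_trans h _.
rewrite le_eqVlt; apply/orP; left; apply/eqP; field.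
by rewrite gt_eqF.
Qed.

Lemma Re_form_expand (p tau tau' s z : R[i]) : tau' = conjc tau ->
  complex.Re (p + conjc (- z) * tau + (- z * tau' + - z * conjc (- z) * s)) =
  complex.Re p - 2 * complex.Re (conjc z * tau) + sqmod z * complex.Re s.
Proof.
move=> ->; rewrite /sqmod; case: p => p p'; case: tau => u v; case: s => s s'; case: z => x y /=.
by ring.
Qed.

End Bounds.

Section SteeringForms.
Context {R : realType} (Nt : nat) (g : geometry R) (W : 'M[R[i]]_Nt).
Local Notation a := (steering Nt g).
Local Notation da := (dsteering Nt g).

Definition form_aa t := complex.Re (\tr (a t *m (a t)^H *m W)).
Definition form_dd t := complex.Re (\tr (da t *m (da t)^H *m W)).
Definition form_da t := \tr (da t *m (a t)^H *m W).

Hypothesis psd : forall v : 'cV[R[i]]_Nt, 0 <= complex.Re (\tr (v *m v^H *m W)).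
Hypothesis herm : forall u v : 'cV[R[i]]_Nt,
  \tr (v *m u^H *m W) = conjc (\tr (u *m v^H *m W)).

Lemma form_aa_ge0 t : 0 <= form_aa t. Proof. exact: psd. Qed.
Lemma form_dd_ge0 t : 0 <= form_dd t. Proof. exact: psd. Qed.

(** Positivity of the form [W] on the vector da - z a. For fixed [z] it is linear in the three
    traces, so it can be averaged over the prior before [z] is optimized. *)
Lemma form_schwarz t (z : R[i]) :
  0 <= form_dd t - 2 * complex.Re (conjc z * form_da t) + sqmod z * form_aa t.
Proof.
apply: le_trans (psd (da t + (- z) *: a t)) _.
rewrite (@tr_form_expand _ (@conjc R : {rmorphism R[i] -> R[i]}) _ W (da t) (a t) (- z)).
by rewrite le_eqVlt (Re_form_expand _ _ _ (herm (da t) (a t))) eqxx.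
Qed.

Definition dsteering_dir t : 'cV[R[i]]_Nt :=
  \col_i ((0 +i* phase g i) * expi (phase g i * sin t)).

Lemma dsteering_cos t : da t = (cos t)%:C *: dsteering_dir t.
Proof.
apply/matrixP => i j; rewrite !mxE mulrA; congr (_ * _).
by apply: complexP => /=; ring.
Qed.

(** Each of the two factors [da] carries one cos t, and what remains is bounded. *)
Lemma form_dd_cos : exists2 M, 0 <= M & forall t, form_dd t <= M * cos t ^+ 2.
Proof.
have bdir : bounded_mxfun dsteering_dir.
  move=> i j; under eq_fun do rewrite mxE; apply: bounded_cfunM; split.
  - exact: bounded_mfun_cst.
  - exact: bounded_mfun_cst.
  - exact: bounded_mfun_cos_phase.
  - exact: bounded_mfun_sin_phase.
have [[_ [M hM]] _] := bounded_tr W (bounded_mxfunM bdir (bounded_mxfunH bdir)).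
exists `|M| => // t; rewrite /form_dd dsteering_cos hermZ.
rewrite -scalemxAl -scalemxAr -!scalemxAl !mxtraceZ mulrA.
have -> : (cos t)%:C * conjc (cos t)%:C = (cos t ^+ 2)%:C.
  by apply: complexP => /=; ring.
rewrite Re_realM mulrC ler_wpM2r ?sqr_ge0//.
by rewrite (le_trans (ler_norm _))// (le_trans (hM t))// ler_norm.
Qed.

Lemma form_aa_bounded : exists2 M, 0 <= M & forall t, form_aa t <= M.
Proof.
have ba := @bounded_steering R Nt g.
have [[_ [M hM]] _] := bounded_tr W (bounded_mxfunM ba (bounded_mxfunH ba)).
exists `|M| => // t.
by rewrite (le_trans (ler_norm _))// (le_trans (hM t))// ler_norm.
Qed.

End SteeringForms.

Lemma sqnorm_ge0 (R : realType) m n (M : 'M[R[i]]_(m, n)) : 0 <= sqnorm M.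
Proof. by apply: sumr_ge0 => ? _; apply: sumr_ge0 => ? _; exact: sqmod_ge0. Qed.

Lemma sqnorm_dsteering_cos (R : realType) N (g : geometry R) t :
  sqnorm (dsteering N g t) = (\sum_(i < N) phase g i ^+ 2) * cos t ^+ 2.
Proof.
rewrite /sqnorm mulr_suml; apply: eq_bigr => i _.
rewrite big_ord_recl big_ord0 addr0 mxE /sqmod ReM ImM /=.
rewrite !mul0r !sub0r !add0r sqrrN !exprMn -mulrDr addrC cos2Dsin2 mulr1.
by [].
Qed.

(** * The chain of bounds *)

Theorem mainTheorem2 (R : realType)
  (disp : measure_display) (Omega : measurableType disp)
  (P : probability Omega R)
  (Nt Nr L K : nat) (Nt1 : (1 <= Nt)%N) (Nr1 : (1 <= Nr)%N)
  (L1 : (1 <= L)%N) (K1 : (1 <= K)%N)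
  (g : geometry R)
  (spacing0 : 0 < spacing g) (wavelength0 : 0 < wavelength g)
  (range0 : 0 < range_ g) (height0 : 0 <= height g)
  (height_le : height g <= range_ g)
  (sigma : R) (sigma0 : 0 < sigma)
  (alpha : R[i]) (alpha0 : alpha != 0)
  (W : 'M[R[i]]_Nt)
  (X : Omega -> 'M[R[i]]_(Nt, L)) (N : Omega -> 'M[R[i]]_(Nr, L))
  (HX : transmit_signal P W X) (HN : awgn P sigma X N)
  (q : mixture R K)
  (weight01 : forall k, 0 <= weight q k <= 1)
  (weight_sum : \sum_k weight q k = 1)
  (mean_itv : forall k, - (pi / 2) <= mean q k < pi / 2)
  (stddev0 : forall k, 0 < stddev q k)
  (F_unit : bayesian_fim P g sigma X N alpha q \in unitmx) :
  let a := steering Nt g in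
  let b := steering Nr g in
  (* The traces below are real wherever complex.Re is applied to them. *)
  let trW (A : 'M[R[i]]_Nt) : R := complex.Re (\tr (A *m W)) in
  let c : R := sigma ^+ 2 / (2 * sqmod alpha * L%:R) in
  let CRB (t : R) : \bar R := inv11 (fim P g sigma X N alpha t) in
  (* Closed form; infinite where the denominator vanishes, as at cos t = 0. *)
  let CRBcf (t : R) : \bar R :=
    (c%:E / (sqnorm (derivmx b t) * trW (a t *m (a t)^H))%:E)%E in
  let PCRB : \bar R :=
    (invmx (bayesian_fim P g sigma X N alpha q) 0 0)%:E in
  let PCRBU : \bar R :=
    (1 / (prior_info q + 2 * sqmod alpha * L%:R / sigma ^+ 2
                         * trW (A1 Nr g q))%:E)%E in
  let mid : \bar R := (c%:E / (trW (A1 Nr g q))%:E)%E in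
  (* The closed form equals [fim^-1]_{1,1} when the Cauchy-Schwarz inequality
     between a and its derivative for the form W is an equality at t, e.g. when
     W has rank at most one; it fails for W = 1%:M and Nt >= 2. *)
  [/\ (forall t : R,
         sqmod (\tr (derivmx a t *m (a t)^H *m W)) =
           trW (derivmx a t *m (derivmx a t)^H) * trW (a t *m (a t)^H) ->
         CRB t = CRBcf t),
      PCRB =
        (1 / (prior_info q + 2 * sqmod alpha * L%:R / sigma ^+ 2
              * (trW (A1 Nr g q + A2 Nr g q)
                 - sqmod (\tr (A3 Nr g q *m W)) / trW (A4 Nr g q)))%:E)%E,
      (mid <= prior_mean q CRB)%E,
      (mid <= prior_mean q CRBcf)%E &
      (PCRBU <= mid)%E /\ (PCRB <= PCRBU)%E].
Proof.
move=> a b trW c CRB CRBcf PCRB PCRBU mid.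
have w0 k : 0 <= weight q k by case/andP: (weight01 k).
have al0 : 0 < sqmod alpha := sqmod_gt0 alpha0.
have L0 : 0 < L%:R :> R by rewrite ltr0n.
have Nr0 : 0 < Nr%:R :> R by rewrite ltr0n.
have sg0 : 0 < sigma ^+ 2 by rewrite exprn_gt0.
have c0 : 0 < c by rewrite divr_gt0// !mulr_gt0.
have psd := covariance_psd L1 HX.
have herm := tr_form_conj L1 HX.
pose k : R := 2 * L%:R / sigma ^+ 2.
have k0 : 0 < k by rewrite divr_gt0// mulr_gt0.
have kc : k * sqmod alpha = c^-1 by rewrite /k /c; field; rewrite !gt_eqF.
pose D t := sqnorm (dsteering Nr g t).
pose T4 := form_aa g W.
pose T2 := form_dd g W.
pose tau := form_da g W.
have T40 t : 0 <= T4 t := form_aa_ge0 g psd t.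
have T20 t : 0 <= T2 t := form_dd_ge0 g psd t.
have D0 t : 0 <= D t := sqnorm_ge0 _.
have [M4 M40 T4M] : exists2 M, 0 <= M & forall t, T4 t <= M := form_aa_bounded g W.
have [M2 M20 T2M] : exists2 M, 0 <= M & forall t, T2 t <= M * cos t ^+ 2 :=
  form_dd_cos g W.
have CRBcfE t : CRBcf t = (c%:E * (D t * T4 t)%:E^-1)%E.
  by rewrite /CRBcf derivmx_steering.
pose m := trW (A1 Nr g q).
pose PI := prior_info q.
have PI0 : 0 <= PI := prior_info_ge0 w0 weight_sum stddev0.
have kappaE : 2 * sqmod alpha * L%:R / sigma ^+ 2 = c^-1.
  by rewrite -kc /k; field; rewrite gt_eqF.
have dbE : derivmx b = dsteering Nr g by apply/funext => t; exact: derivmx_steering.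
have daE : derivmx a = dsteering Nt g by apply/funext => t; exact: derivmx_steering.
have NrE : Nr%:R = (Nr%:R : R)%:C :> R[i] by rewrite rmorph_nat.
have ba := @bounded_steering R Nt g.
have bda := @bounded_dsteering R Nt g.
have bD : bounded_mfun D := bounded_mfun_sqnorm (@bounded_dsteering R Nr g).
have baa := bounded_mxfunM ba (bounded_mxfunH ba).
have bdd := bounded_mxfunM bda (bounded_mxfunH bda).
have bdaa := bounded_mxfunM bda (bounded_mxfunH ba).
have bT4 : bounded_mfun T4 := (bounded_tr W baa).1.
have bT2 : bounded_mfun T2 := (bounded_tr W bdd).1.
have btr : bounded_mfun (fun t => complex.Re (tau t)) := (bounded_tr W bdaa).1.
have bti : bounded_mfun (fun t => complex.Im (tau t)) := (bounded_tr W bdaa).2.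
have A1E : expect q (fun t => D t * T4 t) = m.
  have A1F : A1 Nr g q = integralmx lebesgue_measure
      (fun t => (prior q t)%:C *: ((D t)%:C *: (a t *m (a t)^H))).
    rewrite /A1 dbE; congr integralmx; apply/funext => t.
    by rewrite scalerA -rmorphM mulrC.
  have [e1 _] := expect_tr stddev0 W (bounded_mxfunZ bD baa).
  rewrite /m /trW A1F; apply: etrans e1; apply: eq_Rintegral => t _; congr (_ * _).
  by rewrite -scalemxAl mxtraceZ Re_realM.
have A2E : Nr%:R * expect q T2 = trW (A2 Nr g q).
  rewrite /trW /A2 daE NrE -scalemxAl mxtraceZ Re_realM; congr (_ * _).
  by have [] := expect_tr stddev0 W bdd.
have A4E : Nr%:R * expect q T4 = trW (A4 Nr g q).
  rewrite /trW /A4 NrE -scalemxAl mxtraceZ Re_realM; congr (_ * _).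
  by have [] := expect_tr stddev0 W baa.
pose t3 : R[i] := \tr (A3 Nr g q *m W).
have A3re : Nr%:R * expect q (fun t => complex.Re (tau t)) = complex.Re t3.
  rewrite /t3 /A3 daE NrE -scalemxAl mxtraceZ Re_realM; congr (_ * _).
  by have [] := expect_tr stddev0 W bdaa.
have A3im : Nr%:R * expect q (fun t => complex.Im (tau t)) = complex.Im t3.
  rewrite /t3 /A3 daE NrE -scalemxAl mxtraceZ Im_realM; congr (_ * _).
  by have [] := expect_tr stddev0 W bdaa.
have DM t : D t = (\sum_(i < Nr) phase g i ^+ 2) * cos t ^+ 2.
  exact: sqnorm_dsteering_cos.
have schwarz_t t (z : R[i]) : 0 <= T2 t - 2 * complex.Re (conjc z * tau t) + sqmod z * T4 t :=
  form_schwarz g psd herm t z.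
have fimE t : fim P g sigma X N alpha t = arrow_mx
    (k * (sqmod alpha * (D t * T4 t + Nr%:R * T2 t)))
    (k * (Nr%:R * complex.Re (conjc alpha * tau t)))
    (k * - (Nr%:R * complex.Im (conjc alpha * tau t)))
    (k * (Nr%:R * T4 t)).
  by have h := fim_arrow L1 g sigma0 HX HN alpha t; rewrite h.
have CSE t : sqmod (\tr (derivmx a t *m (a t)^H *m W)) =
    trW (derivmx a t *m (derivmx a t)^H) * trW (a t *m (a t)^H) ->
    sqmod (tau t) = T2 t * T4 t by rewrite daE.
have trWD : trW (A1 Nr g q + A2 Nr g q) = m + trW (A2 Nr g q).
  by rewrite /trW mulmxDl mxtraceD ReD.
clear psd herm dbE daE NrE ba bda baa bdd bdaa.
have mE : trW (A1 Nr g q) = m by [].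
have t3E : \tr (A3 Nr g q *m W) = t3 by [].
have PIE : prior_info q = PI by [].
set (a2 := trW (A2 Nr g q)) in *; set (a4 := trW (A4 Nr g q)) in *.
(* From here on only the recorded equations and inequalities between these quantities matter; they
   become atoms for [ring] and [field]. *)
clearbody a2 a4 D T4 T2 tau k c m t3 PI trW.
(* The Schur complement of the Fisher matrix at [t]. The phase of [alpha] drops out because only
   |conj(alpha) tau|^2 enters. *)
pose S t := c^-1 * (D t * T4 t + Nr%:R * (T2 t - sqmod (tau t) / T4 t)).
have schurE t : T4 t != 0 ->
    k * (sqmod alpha * (D t * T4 t + Nr%:R * T2 t)) -
    ((k * (Nr%:R * complex.Re (conjc alpha * tau t))) ^+ 2 +
     (k * - (Nr%:R * complex.Im (conjc alpha * tau t))) ^+ 2) / (k * (Nr%:R * T4 t)) = S t.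
  move=> t4; rewrite [X in X / _](_ : _ = (k * Nr%:R) ^+ 2 * (sqmod alpha * sqmod (tau t))).
    by rewrite /S -kc; field; rewrite t4 !gt_eqF.
  by rewrite -sqmod_conjM /sqmod; ring.
have sE t : (k * (Nr%:R * T4 t) == 0) = (T4 t == 0).
  by rewrite !mulf_eq0 (gt_eqF k0) (gt_eqF Nr0).
have fim_unit t : (fim P g sigma X N alpha t \in unitmx) = (T4 t != 0) && (S t != 0).
  rewrite fimE arrow_unit sE.
  by case: eqVneq => //= t4; rewrite schurE.
have fim_inv t : fim P g sigma X N alpha t \in unitmx ->
    invmx (fim P g sigma X N alpha t) 0 0 = (S t)^-1.
  move=> fu; have := fu; rewrite fim_unit => /andP[t4 _].
  by move: fu; rewrite fimE => /invmx_arrow ->; rewrite schurE.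
have S_le t : T4 t != 0 -> 0 <= S t <= c^-1 * (D t * T4 t + Nr%:R * T2 t).
  move=> t4; have T4pos : 0 < T4 t by rewrite lt_neqAle eq_sym t4 T40.
  have h1 := schwarz_from_form T4pos (schwarz_t t).
  have h2 : 0 <= sqmod (tau t) / T4 t by rewrite divr_ge0// sqmod_ge0.
  have ci : 0 < c^-1 by rewrite invr_gt0.
  apply/andP; split.
    by rewrite mulr_ge0 ?(ltW ci)// addr_ge0 ?mulr_ge0 ?(ltW Nr0)// subr_ge0.
  by rewrite ler_pM2l// lerD2l ler_pM2l// gerBl.
(* Apart from the final 1, this bounds the angle entry of the Fisher matrix divided by cos^2 t. The
   1 keeps [B] positive when all phases vanish, as for single antennas. *)
pose B := c^-1 * ((\sum_(i < Nr) phase g i ^+ 2) * M4 + Nr%:R * M2) + 1.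
have B0 : 0 < B.
  apply: ltr_wpDl => //; apply: mulr_ge0; first by rewrite invr_ge0 ltW.
  apply: addr_ge0; apply: mulr_ge0 => //.
  by apply: sumr_ge0 => i _; exact: sqr_ge0.
have boundB (t e : R) : 0 < e -> `|cos t| <= e ->
    c^-1 * (D t * T4 t + Nr%:R * T2 t) <= B * e ^+ 2.
  move=> e0 te; have ct : cos t ^+ 2 <= e ^+ 2.
    by rewrite -[cos t ^+ 2]real_normK ?num_real// ler_sqr ?nnegrE// ltW.
  have ci : 0 < c^-1 by rewrite invr_gt0.
  apply: (@le_trans _ _ (B * cos t ^+ 2)); last by rewrite ler_pM2l.
  apply: (@le_trans _ _ ((B - 1) * cos t ^+ 2)); last first.
    by rewrite ler_wpM2r ?sqr_ge0// gerBl.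
  rewrite /B addrK -mulrA ler_pM2l// mulrDl lerD//.
    rewrite DM mulrAC ler_wpM2r ?sqr_ge0// ler_wpM2l//.
    by apply: sumr_ge0 => i _; exact: sqr_ge0.
  by rewrite -mulrA ler_pM2l.
have CRB_infty : prior_mean q CRB = +oo%E.
  apply: (prior_mean_pole w0 weight_sum stddev0 B0) => t.
    rewrite /CRB /inv11; case: ifPn => [fu|_]; last by rewrite le0y.
    rewrite fim_inv// lee_fin invr_ge0.
    by move: fu; rewrite fim_unit => /andP[/S_le /andP[]].
  move=> e e0 te; rewrite /CRB /inv11; case: ifPn => [fu|_]; last exact: leey.
  rewrite fim_inv// lee_fin; move: fu; rewrite fim_unit => /andP[t4 s0].
  have /andP[S0 Sle] := S_le t t4.
  have Spos : 0 < S t by rewrite lt_neqAle eq_sym s0.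
  rewrite lef_pV2 ?posrE//; first exact: le_trans Sle (boundB t e e0 te).
  by rewrite mulr_gt0 ?exprn_gt0.
have CRBcf_infty : prior_mean q CRBcf = +oo%E.
  apply: (prior_mean_pole w0 weight_sum stddev0 B0) => t.
    rewrite CRBcfE mule_ge0//; first by rewrite lee_fin ltW.
    by rewrite inver; case: ifP => // _; rewrite lee_fin invr_ge0 mulr_ge0.
  move=> e e0 te; rewrite CRBcfE.
  have le1 : D t * T4 t <= c * (B * e ^+ 2).
    rewrite -ler_pdivrMl// (le_trans _ (boundB t e e0 te))//.
    by rewrite ler_pM2l ?invr_gt0// lerDl mulr_ge0// ltW.
  have cB0 : 0 < c * (B * e ^+ 2) by rewrite !mulr_gt0 ?exprn_gt0.
  rewrite (_ : (B * e ^+ 2)^-1 = c * (c * (B * e ^+ 2))^-1); last first.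
    by field; rewrite !gt_eqF.
  rewrite EFinM; apply: lee_pmul; rewrite ?lee_fin ?invr_ge0 ?(ltW c0) ?(ltW cB0)//.
  exact: le_inve_fin (mulr_ge0 (D0 t) (T40 t)) le1 cB0.
have m0 : 0 <= m.
  by rewrite -A1E; apply: expect_ge0 => // t; rewrite mulr_ge0.
have bfimE : bayesian_fim P g sigma X N alpha q =
   arrow_mx (PI + c^-1 * (m + a2))
     (k * complex.Re (conjc alpha * t3)) (k * - complex.Im (conjc alpha * t3))
     (k * a4).
  have eJ : expect q (fun t => k * (sqmod alpha * (D t * T4 t + Nr%:R * T2 t))) =
      c^-1 * (m + a2).
    transitivity (expect q (fun t => c^-1 * (D t * T4 t + Nr%:R * T2 t))).
      by apply: eq_Rintegral => t _; rewrite mulrA kc.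
    have b1 := bounded_mfunM bD bT4.
    have b2 := bounded_mfunM (bounded_mfun_cst Nr%:R) bT2.
    by rewrite (expectZ stddev0 _ (bounded_mfunD b1 b2)) (expectD stddev0 b1 b2)
      (expectZ stddev0 _ bT2) A1E A2E.
  (* Both off-diagonal entries are real combinations of Re tau and Im tau, with coefficients read
     off from conj(alpha). *)
  have eLin (x y : R) : expect q (fun t => k * (Nr%:R * (x * complex.Re (tau t) + y * complex.Im (tau t)))) =
      k * (x * complex.Re t3 + y * complex.Im t3).
    have b1 := bounded_mfunM (bounded_mfun_cst x) btr.
    have b2 := bounded_mfunM (bounded_mfun_cst y) bti.
    have b3 := bounded_mfunD b1 b2.
    rewrite (expectZ stddev0 _ (bounded_mfunM (bounded_mfun_cst _) b3)).
    rewrite (expectZ stddev0 _ b3) (expectD stddev0 b1 b2).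
    rewrite (expectZ stddev0 _ btr) (expectZ stddev0 _ bti) -A3re -A3im; congr (_ * _).
    by ring.
  have eu : expect q (fun t => k * (Nr%:R * complex.Re (conjc alpha * tau t))) =
      k * complex.Re (conjc alpha * t3).
    transitivity (k * (complex.Re alpha * complex.Re t3 + complex.Im alpha * complex.Im t3)).
      rewrite -eLin; apply: eq_Rintegral => t _; congr (_ * (_ * _) * _).
      by rewrite ReM Re_conj Im_conj; ring.
    by rewrite ReM Re_conj Im_conj; ring.
  have ev : expect q (fun t => k * - (Nr%:R * complex.Im (conjc alpha * tau t))) =
      k * - complex.Im (conjc alpha * t3).
    transitivity (k * (complex.Im alpha * complex.Re t3 + - complex.Re alpha * complex.Im t3)).
      rewrite -eLin; apply: eq_Rintegral => t _; congr (_ * _).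
      by rewrite ImM Re_conj Im_conj; ring.
    by rewrite ImM Re_conj Im_conj; ring.
  have es : expect q (fun t => k * (Nr%:R * T4 t)) = k * a4.
    have b1 := bounded_mfunM (bounded_mfun_cst Nr%:R) bT4.
    by rewrite (expectZ stddev0 k b1) (expectZ stddev0 Nr%:R bT4) A4E.
  apply/matrixP => i j; rewrite mxE [X in _ + X]mxE [X in _ * X]mxE PIE [X in X + _]mxE.
  have -> : \int[lebesgue_measure]_t (fim P g sigma X N alpha t i j * prior q t) =
      expect q (fun t => (nth [::] [::
        [:: k * (sqmod alpha * (D t * T4 t + Nr%:R * T2 t));
            k * (Nr%:R * complex.Re (conjc alpha * tau t));
            k * - (Nr%:R * complex.Im (conjc alpha * tau t))];
        [:: k * (Nr%:R * complex.Re (conjc alpha * tau t)); k * (Nr%:R * T4 t); 0];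
        [:: k * - (Nr%:R * complex.Im (conjc alpha * tau t)); 0; k * (Nr%:R * T4 t)]] i)`_j).
    by apply: eq_Rintegral => t _; rewrite fimE mxE.
  rewrite [RHS]mxE.
  case: i => [[|[|[|//]]] ?]; case: j => [[|[|[|//]]] ?] /=;
    rewrite ?eJ ?eu ?ev ?es ?expect0 ?mulr0 ?addr0 ?mulr1//; by rewrite addrC.
have DeltaE (x y : R) : y != 0 ->
    PI + c^-1 * (m + x) -
      ((k * complex.Re (conjc alpha * t3)) ^+ 2 +
       (k * - complex.Im (conjc alpha * t3)) ^+ 2) / (k * y) =
    PI + c^-1 * (m + (x - sqmod t3 / y)).
  move=> y0; rewrite [X in X / _](_ : _ = k ^+ 2 * (sqmod alpha * sqmod t3)).
    by rewrite -kc; field; rewrite y0 gt_eqF.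
  by rewrite -sqmod_conjM /sqmod; ring.
(* Invertibility of the averaged matrix supplies both denominators: [a4], and the Schur complement
   whose inverse is the PCRB. *)
have /andP[A4n0 Dn0] : (a4 != 0) &&
    (PI + c^-1 * (m + (a2 - sqmod t3 / a4)) != 0).
  move: F_unit; rewrite bfimE arrow_unit mulf_eq0 (gt_eqF k0) /= => /andP[h1].
  by rewrite DeltaE// h1.
have PCRBE : PCRB = ((PI + c^-1 * (m + (a2 - sqmod t3 / a4)))^-1)%:E.
  by move: F_unit; rewrite /PCRB bfimE => /invmx_arrow ->; rewrite DeltaE.
have A4pos : 0 < a4.
  by rewrite lt_neqAle eq_sym A4n0 -A4E mulr_ge0 ?(ltW Nr0)//; exact: expect_ge0.
have cs : 0 <= a2 - sqmod t3 / a4.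
  (* For each [z] the averaged inequality is the prior mean of the pointwise one; the optimal [z] is
     then that of the averages. *)
  rewrite subr_ge0; apply: (schwarz_from_form A4pos) => z.
  have b1 := bounded_mfunM (bounded_mfun_cst (- 2 * complex.Re z)) btr.
  have b2 := bounded_mfunM (bounded_mfun_cst (- 2 * complex.Im z)) bti.
  have b3 := bounded_mfunM (bounded_mfun_cst (sqmod z)) bT4.
  have -> : a2 - 2 * complex.Re (conjc z * t3) + sqmod z * a4 =
      Nr%:R * expect q (fun t => T2 t + ((- 2 * complex.Re z) * complex.Re (tau t) +
        ((- 2 * complex.Im z) * complex.Im (tau t) + sqmod z * T4 t))).
    rewrite (expectD stddev0 bT2 (bounded_mfunD b1 (bounded_mfunD b2 b3))).
    rewrite (expectD stddev0 b1 (bounded_mfunD b2 b3)) (expectD stddev0 b2 b3).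
    rewrite (expectZ stddev0 _ btr) (expectZ stddev0 _ bti) (expectZ stddev0 _ bT4).
    rewrite -A2E -A4E ReM Re_conj Im_conj -A3re -A3im.
    move: (expect q T2) (expect q T4) (expect q (fun t => complex.Re (tau t)))
      (expect q (fun t => complex.Im (tau t))) (complex.Re z) (complex.Im z) (sqmod z).
    by clear => *; ring.
  rewrite mulr_ge0 ?(ltW Nr0)//; apply: expect_ge0 => // t.
  have := schwarz_t t z; rewrite ReM Re_conj Im_conj => h.
  by apply: le_trans h _; rewrite le_eqVlt; apply/orP; left; apply/eqP; ring.
split.
- move=> t /CSE CS.
  rewrite CRBcfE /CRB /inv11; case: ifPn => [fu|].
    rewrite fim_inv//; move: fu; rewrite fim_unit => /andP[t4].
    have -> : S t = c^-1 * (D t * T4 t) by rewrite /S CS; field; rewrite t4 gt_eqF.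
    rewrite mulf_eq0 negb_or => /andP[_ dt]; rewrite inver (negbTE dt) -EFinM.
    by rewrite invfM invrK.
  (* At a singular point both sides are [+oo]: either T4 t = 0, or the Schur complement, reduced by
     the equality case to D t T4 t / c, vanishes. *)
  rewrite fim_unit negb_and !negbK => h.
  suff -> : D t * T4 t = 0 by rewrite inve0 gt0_muley// lte_fin.
  have [t40|t4] := eqVneq (T4 t) 0; first by rewrite t40 mulr0.
  move: h; rewrite (negbTE t4) /= /S CS mulfK// subrr mulr0 addr0.
  by rewrite mulf_eq0 invr_eq0 gt_eqF//= => /eqP.
- by rewrite PCRBE kappaE trWD t3E PIE -addrA one_div_fin.
- by rewrite CRB_infty leey.
- by rewrite CRBcf_infty leey.
- rewrite /PCRBU /mid kappaE mE PIE PCRBE; split.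
    (* If m = 0 then [mid] is [+oo], whatever the value of [PCRBU]. *)
    have [->|mn0] := eqVneq m 0; first by rewrite inve0 gt0_muley ?lte_fin// leey.
    have mpos : 0 < m by rewrite lt_neqAle eq_sym mn0.
    have cm : 0 < c^-1 * m by rewrite mulr_gt0 ?invr_gt0.
    have sp : 0 < PI + c^-1 * m by rewrite ltr_wpDl.
    rewrite one_div_fin ?gt_eqF// inver (negbTE mn0) -EFinM lee_fin.
    have -> : c * m^-1 = (c^-1 * m)^-1 by rewrite invfM invrK.
    by rewrite lef_pV2 ?posrE// lerDr.
  rewrite mul1e; have x0 : 0 <= PI + c^-1 * m.
    by rewrite addr_ge0// mulr_ge0// invr_ge0 ltW.
  have xy : PI + c^-1 * m <=
      PI + c^-1 * (m + (a2 - sqmod t3 / a4)).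
    by rewrite lerD2l ler_pM2l ?invr_gt0// lerDl.
  (* The denominator of [PCRBU] may be 0, in which case [PCRBU] is [+oo]; that of the PCRB is
     nonzero by invertibility. *)
  by apply: le_inve_fin => //; rewrite lt_neqAle eq_sym Dn0 (le_trans x0 xy).
Qed.
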